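(* For every rational $0<s<1$, the set $\{e:\mathcal H^s([T_e])>0\}$ is $\Sigma^0_2$-complete.
   Context: For each $e$, $T_e=\{\sigma\in2^{<\omega}:\forall\tau\subseteq\sigma\ \varphi_{e,|\sigma|}(\tau)\uparrow\}$ is the $e$-th recursive tree, where $\varphi_{e,t}$ denotes the $e$-th partial recursive function run for $t$ steps; $[T]$ denotes the set of infinite paths through $T$. Cantor space $2^\omega$ carries the metric $d(x,y)=2^{-\min\{n:x(n)\ne y(n)\}}$ for $x\ne y$; $\mathcal H^s$ denotes $s$-dimensional Hausdorff measure with respect to this metric. *)

(* Defs.v *)
From Stdlib Require Import Reals Arith List Cantor ClassicalEpsilon.
Import ListNotations.
Open Scope R_scope.

Inductive instr : Type :=
| INC (r j : nat)          (* reg r += 1; goto j *)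
| DEC (r j k : nat).       (* if reg r = 0 goto k else (reg r -= 1; goto j) *)

Definition instr_of_nat (n : nat) : instr :=
  let (tag, rest) := Cantor.of_nat n in
  match tag with
  | O => let (r, j) := Cantor.of_nat rest in INC r j
  | S _ => let (r, jk) := Cantor.of_nat rest in
           let (j, k) := Cantor.of_nat jk in DEC r j k
  end.

Fixpoint decode_prog_fuel (fuel m : nat) : list instr :=
  match fuel with
  | O => []
  | S f => match m with
           | O => []
           | S m' => let (a, b) := Cantor.of_nat m' in
                     instr_of_nat a :: decode_prog_fuel f b
           end
  end.

Definition decode_prog (e : nat) : list instr := decode_prog_fuel e e.

Definition config : Type := (nat * (nat -> nat))%type.

Definition upd (regs : nat -> nat) (r v : nat) : nat -> nat :=
  fun i => if Nat.eqb i r then v else regs i.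

(* one step; None = the machine has halted (pc outside the program) *)
Definition step (p : list instr) (c : config) : option config :=
  let (pc, regs) := c in
  match nth_error p pc with
  | None => None
  | Some (INC r j) => Some (j, upd regs r (S (regs r)))
  | Some (DEC r j k) =>
      match regs r with
      | O => Some (k, regs)
      | S v => Some (j, upd regs r v)
      end
  end.

Fixpoint run (p : list instr) (t : nat) (c : config) : option nat :=
  match step p c with
  | None => Some (snd c 0%nat)
  | Some c' => match t with
               | O => None
               | S t' => run p t' c'
               end
  end.

Definition phi (e t n : nat) : option nat :=
  run (decode_prog e) t (0%nat, fun r => if Nat.eqb r 0 then n else 0%nat).

Definition pair (a b : nat) : nat := Cantor.to_nat (a, b).

Definition computable (f : nat -> nat) : Prop :=
  exists i, forall n, exists t, phi i t n = Some (f n).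

Definition recursive_pred (R : nat -> Prop) : Prop :=
  exists i, forall n, exists t m, phi i t n = Some m /\ (R n <-> m = 0%nat).

Definition Sigma02 (A : nat -> Prop) : Prop :=
  exists R : nat -> Prop, recursive_pred R /\
    forall e, A e <-> exists a, forall b, R (pair e (pair a b)).

Definition Sigma02_complete (A : nat -> Prop) : Prop :=
  Sigma02 A /\
  forall B : nat -> Prop, Sigma02 B ->
    exists f, computable f /\ forall n, B n <-> A (f n).

(* bijective coding of 2^{<omega} into nat *)
Fixpoint code_str (s : list bool) : nat :=
  match s with
  | [] => 0%nat
  | b :: s' => S (2 * code_str s' + (if b then 1 else 0))%nat
  end.

Definition is_prefix (tau sigma : list bool) : Prop :=
  exists rho, sigma = tau ++ rho.

Definition T (e : nat) (sigma : list bool) : Prop :=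
  forall tau, is_prefix tau sigma -> phi e (length sigma) (code_str tau) = None.

Definition restr (x : nat -> bool) (n : nat) : list bool :=
  map x (seq 0 n).

Definition paths (Tr : list bool -> Prop) (x : nat -> bool) : Prop :=
  forall n, Tr (restr x n).

Definition cantor := nat -> bool.

Definition dist (x y : cantor) : R :=
  epsilon (inhabits 0)
    (fun r => (x = y /\ r = 0) \/
              exists n, x n <> y n /\ (forall m, (m < n)%nat -> x m = y m)
                        /\ r = / 2 ^ n).

Definition diam (U : cantor -> Prop) : R :=
  epsilon (inhabits 0)
    (fun r => is_lub (fun v => exists x y, U x /\ U y /\ v = dist x y) r
              \/ ((~ exists x, U x) /\ r = 0)).

Definition rpow (r s : R) : R := if Rlt_dec 0 r then Rpower r s else 0.

(* for a series with nonnegative terms: sum_i a_i >= c (the sum may be +oo) *)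
Definition series_ge (a : nat -> R) (c : R) : Prop :=
  forall c', c' < c -> exists N, c' < sum_f_R0 a N.

Definition Hpre_ge (s delta : R) (X : cantor -> Prop) (c : R) : Prop :=
  forall U : nat -> cantor -> Prop,
    (forall i, diam (U i) <= delta) ->
    (forall x, X x -> exists i, U i x) ->
    series_ge (fun i => rpow (diam (U i)) s) c.

(* H^s(X) = sup_{delta>0} H^s_delta(X) = sup_{delta>0} inf_covers sum > 0 *)
Definition Hausdorff_pos (s : R) (X : cantor -> Prop) : Prop :=
  exists delta c, 0 < delta /\ 0 < c /\ Hpre_ge s delta X c.

(* Main.v *)
(* Up to a factor 2, the s-dimensional weight of a cylinder of length l is 2^-floor(lp/q), and every
   set of Cantor space lies in a cylinder of about the same diameter.  By compactness, H^s([T_e]) > 0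
   therefore holds iff for some a every finite family of cylinders covering a level of T_e has
   weight at least 2^-a; the matrix of this statement is decidable, so it is Sigma^0_2.

   Hardness: let B n <-> exists a, forall b, R n a b.  A string extending 0^a 1 is killed as soon as
   it is long enough to exhibit some b with ~ R n a b.  If a is a witness for B n, the tree contains
   the whole cylinder 0^a 1, which has positive measure since s < 1; otherwise 0^omega is its only
   possible path.

   Recursiveness is obtained from a class [PR] of functions computed by structured loop programs
   that compile to the counter machine, shown to contain a simulator of that machine. *)

Require Import Defs.
From Stdlib Require Import Reals Arith List Cantor ClassicalEpsilon.
From Stdlib Require Import Lia Lra FunctionalExtensionality Classical Wf_nat.
(* [Reals] has its own [dist]. *)
Import Defs ListNotations.
Open Scope nat_scope.

(** The covering criterion mentions no bound on diameters: a family of total weight below 2^-a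
    contains only cylinders longer than a, so cheap covers are fine automatically, and positive
    measure amounts to positive Hausdorff content. Rounding the exponent to floor(lp/q) makes the
    weights computable and is the only source of the factor 2; multiplied by 2^m, the weights of a
    level-m cover become natural numbers, so the matrix is pure arithmetic.

    On the machine side there are two obstacles. The criterion speaks of step-bounded computations,
    so these must be evaluated by the counter machine itself. And a tree loses a string only because
    a program halts on the code of one of its prefixes, so the reduction must compute from n the
    code of a program with n built in: an s-m-n theorem for explicit instruction lists. All
    functions take one argument, and tuples are packed by [pair]. *)

(** * Structured programs and their compilation to the counter machine *)

Inductive cmd : Type :=
| Skip
| Inc (r : nat)
| Seq (c d : cmd)
| Loop (r : nat) (c : cmd).

(** [Loop r c] is a while loop: [r] is decremented before each round and tested again afterwards,
    and the body may change it. Only terminating executions are described. *)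
Inductive exec : cmd -> (nat -> nat) -> (nat -> nat) -> Prop :=
| exec_skip s : exec Skip s s
| exec_inc r s : exec (Inc r) s (upd s r (S (s r)))
| exec_seq c d s1 s2 s3 : exec c s1 s2 -> exec d s2 s3 -> exec (Seq c d) s1 s3
| exec_loop0 r c s : s r = 0 -> exec (Loop r c) s s
| exec_loopS r c v s1 s2 s3 : s1 r = S v -> exec c (upd s1 r v) s2 ->
    exec (Loop r c) s2 s3 -> exec (Loop r c) s1 s3.

Fixpoint csize (c : cmd) : nat :=
  match c with
  | Skip => 0
  | Inc _ => 1
  | Seq c d => csize c + csize d
  | Loop _ c => S (csize c + 1)
  end.

(* The test of a loop is repeated at its end, so no unconditional jump is needed. *)
Fixpoint compile (o : nat) (c : cmd) : list instr :=
  match c with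
  | Skip => []
  | Inc r => [INC r (S o)]
  | Seq c d => compile o c ++ compile (o + csize c) d
  | Loop r c => DEC r (S o) (o + S (csize c + 1)) :: compile (S o) c
                  ++ [DEC r (S o) (o + S (csize c + 1))]
  end.

Lemma compile_length c : forall o, length (compile o c) = csize c.
Proof.
  induction c; intros o; simpl; auto.
  - now rewrite length_app, IHc1, IHc2.
  - now rewrite length_app, IHc.
Qed.

Inductive steps (P : list instr) : nat -> config -> config -> Prop :=
| steps_refl c : steps P 0 c c
| steps_step t c1 c2 c3 : step P c1 = Some c2 -> steps P t c2 c3 -> steps P (S t) c1 c3.

Lemma steps_trans P t1 t2 c1 c2 c3 :
  steps P t1 c1 c2 -> steps P t2 c2 c3 -> steps P (t1 + t2) c1 c3.
Proof. induction 1; simpl; eauto using steps_step. Qed.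

Definition code_at (P : list instr) (o : nat) (C : list instr) : Prop :=
  forall i x, nth_error C i = Some x -> nth_error P (o + i) = Some x.

Lemma code_at_app P o C D :
  code_at P o (C ++ D) -> code_at P o C /\ code_at P (o + length C) D.
Proof.
  intros H; split; intros i x Hi.
  - apply H. rewrite nth_error_app1; auto. apply nth_error_Some; congruence.
  - rewrite <- Nat.add_assoc. apply H. rewrite nth_error_app2 by lia.
    now replace (length C + i - length C) with i by lia.
Qed.

Lemma code_at_cons P o x C :
  code_at P o (x :: C) -> nth_error P o = Some x /\ code_at P (S o) C.
Proof.
  intros H; split.
  - rewrite <- (Nat.add_0_r o). now apply H.
  - intros i y Hi. replace (S o + i) with (o + S i) by lia. now apply H.
Qed.

(* The loop case needs the statement for both copies of the test, hence the second conjunct. *)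
Lemma compile_correct c s s' : exec c s s' -> forall P o, code_at P o (compile o c) ->
  (exists t, steps P t (o, s) (o + csize c, s')) /\
  (forall r d, c = Loop r d ->
     exists t, steps P t (o + S (csize d), s) (o + csize c, s')).
Proof.
  induction 1; intros P o HC; simpl in HC.
  - split; [|discriminate]. exists 0. rewrite Nat.add_0_r. constructor.
  - split; [|discriminate]. apply code_at_cons in HC as [HC _].
    exists 1. simpl. rewrite Nat.add_1_r. eapply steps_step; [|constructor].
    simpl. now rewrite HC.
  - split; [|discriminate]. apply code_at_app in HC as [H1 H2].
    rewrite compile_length in H2.
    destruct (IHexec1 _ _ H1) as [[t1 S1] _], (IHexec2 _ _ H2) as [[t2 S2] _].
    exists (t1 + t2). simpl. rewrite Nat.add_assoc. eapply steps_trans; eauto.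
  - apply code_at_cons in HC as [H1 HC]. apply code_at_app in HC as [_ H2].
    apply code_at_cons in H2 as [H2 _]. rewrite compile_length in H2.
    split; [|intros r' d [= <- <-]]; exists 1;
      (eapply steps_step; [|constructor]); simpl.
    + now rewrite H1, H.
    + replace (o + S (csize c)) with (S o + csize c) by lia. now rewrite H2, H.
  - assert (HC' := HC).
    apply code_at_cons in HC as [H2 HC]. apply code_at_app in HC as [H3 H4].
    apply code_at_cons in H4 as [H4 _]. rewrite compile_length in H4.
    destruct (IHexec1 _ _ H3) as [[t1 S1] _].
    destruct (IHexec2 P o HC') as [_ IH]. destruct (IH _ _ eq_refl) as [t2 S2].
    replace (o + S (csize c)) with (S o + csize c) in * by lia.
    split; [|intros r' d [= <- <-]]; exists (S (t1 + t2));
      (eapply steps_step; [|eapply steps_trans; eauto]); simpl.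
    + now rewrite H2, H.
    + replace (o + S (csize c)) with (S o + csize c) by lia. now rewrite H4, H.
Qed.

(** * Runs of the machine and codes of programs *)

Lemma run_steps P t c c' n : steps P t c c' -> run P (t + n) c = run P n c'.
Proof. induction 1; simpl; auto. now rewrite H. Qed.

Lemma run_S P t c v : run P t c = Some v -> run P (S t) c = Some v.
Proof.
  revert c; induction t; intros c; simpl.
  - destruct (step P c) as [c'|] eqn:E; [discriminate|auto].
  - destruct (step P c) as [c'|] eqn:E; auto. intros H. apply IHt in H. exact H.
Qed.

Lemma run_mono P t t' c v : t <= t' -> run P t c = Some v -> run P t' c = Some v.
Proof. induction 1; auto using run_S. Qed.

Lemma phi_mono e t t' n v : t <= t' -> phi e t n = Some v -> phi e t' n = Some v.
Proof. apply run_mono. Qed.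

Lemma phi_det e t t' n v v' : phi e t n = Some v -> phi e t' n = Some v' -> v = v'.
Proof.
  intros H H'. apply (phi_mono _ _ (max t t')) in H, H'; try lia. congruence.
Qed.

Lemma of_nat_pair a b : Cantor.of_nat (pair a b) = (a, b).
Proof. apply cancel_of_to. Qed.

Lemma pair_snd_le a b : b <= pair a b.
Proof. unfold pair, to_nat. simpl. lia. Qed.

Definition instr_code (x : instr) : nat :=
  match x with
  | INC r j => pair 0 (pair r j)
  | DEC r j k => pair 1 (pair r (pair j k))
  end.

Fixpoint prog_code (P : list instr) : nat :=
  match P with
  | [] => 0
  | x :: P => S (pair (instr_code x) (prog_code P))
  end.

Lemma instr_code_correct x : instr_of_nat (instr_code x) = x.
Proof. destruct x; unfold instr_of_nat, instr_code; now rewrite !of_nat_pair. Qed.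

Lemma prog_code_correct P : decode_prog (prog_code P) = P.
Proof.
  unfold decode_prog.
  assert (H : forall f, prog_code P <= f -> decode_prog_fuel f (prog_code P) = P).
  { induction P as [|x P IH]; intros [|f] Hf; simpl in *; auto; [lia|].
    rewrite of_nat_pair, instr_code_correct. f_equal. apply IH.
    assert (H := pair_snd_le (instr_code x) (prog_code P)). lia. }
  auto.
Qed.

(** * Executing elementary programs on registers *)

Ltac upd_simpl :=
  unfold upd; cbv beta;
  repeat match goal with
  | |- context [Nat.eqb ?a ?b] =>
      first [ replace (Nat.eqb a b) with false by (symmetry; apply Nat.eqb_neq; lia)
            | replace (Nat.eqb a b) with true by (symmetry; apply Nat.eqb_eq; lia)
            | destruct (Nat.eqb_spec a b); [subst a|] ]
  end; try lia; auto.

Ltac st_eq := apply functional_extensionality; intros ?j; upd_simpl.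

Lemma upd_same s r v : upd s r v r = v.
Proof. unfold upd. now rewrite Nat.eqb_refl. Qed.

Lemma upd_other s r v i : i <> r -> upd s r v i = s i.
Proof. intros H. unfold upd. now destruct (Nat.eqb_spec i r). Qed.

(** The loop invariant is an explicit family of states, indexed by the remaining value of the
    counter [r]; each use below only has to guess this family. *)
Lemma exec_loop_family r c (I : nat -> nat -> nat) n :
  (forall v, v <= n -> I v r = v) ->
  (forall v, v < n -> exec c (upd (I (S v)) r v) (I v)) ->
  exec (Loop r c) (I n) (I 0).
Proof.
  induction n as [|n IH]; intros H0 H.
  - apply exec_loop0; auto.
  - apply exec_loopS with (v := n) (s2 := I n); auto.
Qed.

Definition clear (a : nat) : cmd := Loop a Skip.
Definition move (a b : nat) : cmd := Loop a (Inc b).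
Definition dup (a b c : nat) : cmd := Loop a (Seq (Inc b) (Inc c)).

Lemma exec_eq c s s1 s2 : exec c s s1 -> s1 = s2 -> exec c s s2.
Proof. now intros ? <-. Qed.

Lemma exec_clear a s : exec (clear a) s (upd s a 0).
Proof.
  assert (H := exec_loop_family a Skip (fun v => upd s a v) (s a)).
  cbv beta in H. replace (upd s a (s a)) with s in H by st_eq.
  apply H.
  - intros; apply upd_same.
  - intros v _. eapply exec_eq; [constructor|st_eq].
Qed.

Lemma exec_move a b s : a <> b ->
  exec (move a b) s (upd (upd s b (s b + s a)) a 0).
Proof.
  intros Hab.
  assert (H := exec_loop_family a (Inc b)
                 (fun v => upd (upd s b (s b + (s a - v))) a v) (s a)).
  cbv beta in H. rewrite Nat.sub_0_r, Nat.sub_diag, Nat.add_0_r in H.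
  replace (upd (upd s b (s b)) a (s a)) with s in H by st_eq.
  apply H.
  - intros; apply upd_same.
  - intros v Hv. eapply exec_eq; [constructor|].
    st_eq.
Qed.

Lemma exec_dup a b c s : a <> b -> a <> c -> b <> c ->
  exec (dup a b c) s (upd (upd (upd s b (s b + s a)) c (s c + s a)) a 0).
Proof.
  intros Hab Hac Hbc.
  assert (H := exec_loop_family a (Seq (Inc b) (Inc c))
    (fun v => upd (upd (upd s b (s b + (s a - v))) c (s c + (s a - v))) a v) (s a)).
  cbv beta in H. rewrite Nat.sub_0_r, Nat.sub_diag, !Nat.add_0_r in H.
  replace (upd (upd (upd s b (s b)) c (s c)) a (s a)) with s in H by st_eq.
  apply H.
  - intros; apply upd_same.
  - intros v Hv. eapply exec_seq; [constructor|]. eapply exec_eq; [constructor|].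
    st_eq.
Qed.

(** * The class [PR] and its closure properties *)

(** Register [k] carries the argument and the result; the registers above it are scratch space, zero
    before and after; those below keep their contents. Since [k] is arbitrary, a program can be run
    above live data, and programs compose without renaming registers. *)
Definition PR (f : nat -> nat) : Prop :=
  forall k, exists c, forall s, (forall j, k < j -> s j = 0) ->
    exec c s (upd s k (f (s k))).

Lemma PR_ext f g : (forall x, f x = g x) -> PR f -> PR g.
Proof.
  intros E H k. destruct (H k) as [c Hc]. exists c. intros s Hs.
  rewrite <- E. auto.
Qed.

Lemma PR_id : PR (fun x => x).
Proof.
  intros k. exists Skip. intros s _. eapply exec_eq; [constructor|st_eq].
Qed.

Lemma PR_comp f g : PR f -> PR g -> PR (fun x => f (g x)).
Proof.
  intros Hf Hg k. destruct (Hf k) as [c Hc], (Hg k) as [d Hd].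
  exists (Seq d c). intros s Hs. eapply exec_seq; [apply Hd; auto|].
  eapply exec_eq; [apply Hc|]; [|rewrite upd_same; st_eq].
  intros j Hj. rewrite upd_other by lia. auto.
Qed.

Lemma PR_S f : PR f -> PR (fun x => S (f x)).
Proof.
  apply (PR_comp S). intros k. exists (Inc k). intros s _. constructor.
Qed.

Lemma PR_0 : PR (fun _ => 0).
Proof. intros k. exists (clear k). intros s _. apply exec_clear. Qed.

Lemma PR_const n : PR (fun _ => n).
Proof. induction n; auto using PR_0, PR_S. Qed.

(** Triangular numbers, in the exact form in which they occur in [Cantor.to_nat], so that [pair_tri]
    holds by conversion. *)
Definition tri (n : nat) : nat := nat_rec _ 0 (fun i m => S i + m) n.

Lemma pair_tri a b : pair a b = b + tri (b + a).
Proof. reflexivity. Qed.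

Ltac st_zero Hs :=
  st_eq; repeat match goal with |- context [?s ?j] =>
    match type of Hs with context [s] => rewrite (Hs j) by lia end end; try lia.

(* The triangular number of register k is accumulated in register k+1; the summand is in k+2. *)
Lemma exec_tri k s : (forall j, S k < j -> s j = 0) ->
  exec (Seq (Loop k (Seq (Inc (2 + k)) (Seq (dup (2 + k) (1 + k) (3 + k)) (move (3 + k) (2 + k)))))
            (clear (2 + k)))
    s (upd (upd s (1 + k) (s (1 + k) + tri (s k))) k 0).
Proof.
  intros Hs. set (n := s k).
  apply exec_seq with (s2 := upd (upd (upd s (1 + k) (s (1 + k) + tri n)) (2 + k) n) k 0).
  - assert (H := exec_loop_family k
      (Seq (Inc (2 + k)) (Seq (dup (2 + k) (1 + k) (3 + k)) (move (3 + k) (2 + k)))) (fun v =>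
      upd (upd (upd s (1 + k) (s (1 + k) + (tri (n - v)))) (2 + k) (n - v)) k v) n).
    cbv beta in H. rewrite Nat.sub_diag, Nat.sub_0_r in H.
    replace (upd _ k n) with s in H by (simpl tri; unfold n; st_zero Hs).
    apply H.
    + intros; apply upd_same.
    + intros v Hv. assert (E : n - v = S (n - S v)) by lia.
      eapply exec_seq; [constructor|]. eapply exec_seq; [apply exec_dup; lia|].
      eapply exec_eq; [apply exec_move; lia|].
      rewrite E. simpl tri. st_zero Hs.
  - eapply exec_eq; [apply exec_clear|]. st_zero Hs.
Qed.

(** Both programs run at register [k + 1] while the other value is parked in register [k]; after
    each run the two registers are swapped. *)
Lemma PR_fork f g : PR f -> PR g -> forall k, exists c, forall s, (forall j, k < j -> s j = 0) ->
  exec c s (upd (upd s k (f (s k))) (1 + k) (g (s k))).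
Proof.
  intros Hf Hg k. destruct (Hg (1 + k)) as [c Hc], (Hf (1 + k)) as [d Hd].
  exists (Seq (Seq (dup k (1 + k) (2 + k)) (move (2 + k) k)) (Seq c
    (Seq (Seq (move k (2 + k)) (Seq (move (1 + k) k) (move (2 + k) (1 + k))))
    (Seq d (Seq (move k (2 + k)) (Seq (move (1 + k) k) (move (2 + k) (1 + k)))))))).
  intros s Hs.
  apply exec_seq with (s2 := upd s (1 + k) (s k)).
  { eapply exec_seq; [apply exec_dup; lia|].
    eapply exec_eq; [apply exec_move; lia|]. st_zero Hs. }
  eapply exec_seq.
  { apply Hc. intros j Hj. rewrite upd_other by lia. apply Hs; lia. }
  rewrite upd_same.
  apply exec_seq with (s2 := upd (upd s (1 + k) (s k)) k (g (s k))).
  { eapply exec_seq; [apply exec_move; lia|]. eapply exec_seq; [apply exec_move; lia|].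
    eapply exec_eq; [apply exec_move; lia|]. st_zero Hs. }
  eapply exec_seq.
  { apply Hd. intros j Hj. rewrite !upd_other by lia. apply Hs; lia. }
  eapply exec_seq; [apply exec_move; lia|]. eapply exec_seq; [apply exec_move; lia|].
  eapply exec_eq; [apply exec_move; lia|]. st_zero Hs.
Qed.

Lemma exec_pair k : exists c, forall s, (forall j, 1 + k < j -> s j = 0) ->
  exec c s (upd (upd s k (pair (s k) (s (1 + k)))) (1 + k) 0).
Proof.
  eexists (Seq (Seq (dup (1 + k) (2 + k) (3 + k)) (Seq (move (2 + k) (1 + k)) (move (3 + k) k)))
    (Seq _ (move (1 + k) k))).
  intros s Hs.
  apply exec_seq with (s2 := upd (upd s k (s (1 + k) + s k)) (1 + k) (s (1 + k))).
  { eapply exec_seq; [apply exec_dup; lia|]. eapply exec_seq; [apply exec_move; lia|].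
    eapply exec_eq; [apply exec_move; lia|]. st_zero Hs. }
  eapply exec_seq.
  { apply (exec_tri k). intros j Hj. rewrite !upd_other by lia. apply Hs; lia. }
  eapply exec_eq; [apply exec_move; lia|].
  rewrite pair_tri. st_zero Hs.
Qed.

Lemma PR_pair f g : PR f -> PR g -> PR (fun x => pair (f x) (g x)).
Proof.
  intros Hf Hg k. destruct (PR_fork f g Hf Hg k) as [c Hc], (exec_pair k) as [d Hd].
  exists (Seq c d). intros s Hs. eapply exec_seq; [apply Hc; auto|].
  eapply exec_eq; [apply Hd|].
  - intros j Hj. rewrite !upd_other by lia. apply Hs; lia.
  - st_zero Hs.
Qed.

Definition nfst (n : nat) : nat := fst (Cantor.of_nat n).
Definition nsnd (n : nat) : nat := snd (Cantor.of_nat n).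

Lemma nfst_pair a b : nfst (pair a b) = a.
Proof. unfold nfst. now rewrite of_nat_pair. Qed.

Lemma nsnd_pair a b : nsnd (pair a b) = b.
Proof. unfold nsnd. now rewrite of_nat_pair. Qed.

Ltac pair_simpl := repeat (rewrite nfst_pair || rewrite nsnd_pair).

Lemma pair_eta n : pair (nfst n) (nsnd n) = n.
Proof.
  unfold pair, nfst, nsnd. rewrite <- surjective_pairing. apply cancel_to_of.
Qed.

(* Follows the recursion of [Cantor.of_nat]; register k+3 holds the flag "first component is 0". *)
Definition unpair_step (k : nat) : cmd :=
  Seq (Inc (3 + k)) (Seq
    (Loop (1 + k) (Seq (move (1 + k) (4 + k)) (Seq (clear (3 + k)) (Inc (2 + k)))))
    (Seq (Loop (3 + k) (Seq (move (2 + k) (1 + k)) (Inc (1 + k)))) (move (4 + k) (1 + k)))).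

Lemma nfst_S n : nfst (S n) = match nfst n with 0 => S (nsnd n) | S x => x end.
Proof. unfold nfst, nsnd. simpl. destruct (of_nat n) as [[|x] y]; reflexivity. Qed.

Lemma nsnd_S n : nsnd (S n) = match nfst n with 0 => 0 | S _ => S (nsnd n) end.
Proof. unfold nfst, nsnd. simpl. destruct (of_nat n) as [[|x] y]; reflexivity. Qed.

Lemma exec_unpair_step k s n : (forall j, 2 + k < j -> s j = 0) ->
  s (1 + k) = nfst n -> s (2 + k) = nsnd n ->
  exec (unpair_step k) s (upd (upd s (1 + k) (nfst (S n))) (2 + k) (nsnd (S n))).
Proof.
  intros Hs H1 H2. rewrite nfst_S, nsnd_S. rewrite <- H1, <- H2.
  eapply exec_seq; [constructor|]. rewrite (Hs (3 + k)) by lia.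
  destruct (s (1 + k)) as [|x] eqn:E.
  - eapply exec_seq; [apply exec_loop0; rewrite upd_other by lia; auto|].
    eapply exec_seq.
    { eapply exec_loopS; [apply upd_same| |].
      - eapply exec_seq; [apply exec_move; lia|constructor].
      - apply exec_loop0. upd_simpl. }
    eapply exec_eq; [apply exec_move; lia|]. st_zero Hs.
  - eapply exec_seq.
    { eapply exec_loopS; [rewrite upd_other by lia; exact E| |].
      - eapply exec_seq; [apply exec_move; lia|].
        eapply exec_seq; [apply exec_clear|constructor].
      - apply exec_loop0. upd_simpl. }
    eapply exec_seq; [apply exec_loop0; upd_simpl|].
    eapply exec_eq; [apply exec_move; lia|]. st_zero Hs.
Qed.

(** Unpairing by counting: 0 codes the pair (0, 0), and the successor step on pairs is carried out
    as often as the argument says. *)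
Lemma exec_unpair k : exists c, forall s, (forall j, k < j -> s j = 0) ->
  exec c s (upd (upd s k (nfst (s k))) (1 + k) (nsnd (s k))).
Proof.
  exists (Seq (Loop k (unpair_step k)) (Seq (move (1 + k) k) (move (2 + k) (1 + k)))).
  intros s Hs. set (n := s k).
  apply exec_seq with (s2 := upd (upd (upd s (1 + k) (nfst n)) (2 + k) (nsnd n)) k 0).
  - assert (H := exec_loop_family k (unpair_step k) (fun v =>
      upd (upd (upd s (1 + k) (nfst (n - v))) (2 + k) (nsnd (n - v))) k v) n).
    cbv beta in H. rewrite Nat.sub_diag, Nat.sub_0_r in H.
    replace (upd _ k n) with s in H.
    2:{ change (nfst 0) with 0. change (nsnd 0) with 0. unfold n. st_zero Hs. }
    apply H.
    + intros; apply upd_same.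
    + intros v Hv. assert (E : n - v = S (n - S v)) by lia.
      eapply exec_eq; [apply (exec_unpair_step k _ (n - S v))|].
      * intros j Hj. rewrite !upd_other by lia. apply Hs; lia.
      * upd_simpl.
      * upd_simpl.
      * rewrite E. st_zero Hs.
  - eapply exec_seq; [apply exec_move; lia|].
    eapply exec_eq; [apply exec_move; lia|]. st_zero Hs.
Qed.

Lemma PR_nfst f : PR f -> PR (fun x => nfst (f x)).
Proof.
  apply (PR_comp nfst). intros k. destruct (exec_unpair k) as [c Hc].
  exists (Seq c (clear (1 + k))). intros s Hs. eapply exec_seq; [apply Hc; auto|].
  eapply exec_eq; [apply exec_clear|]. st_zero Hs.
Qed.

Lemma PR_nsnd f : PR f -> PR (fun x => nsnd (f x)).
Proof.
  apply (PR_comp nsnd). intros k. destruct (exec_unpair k) as [c Hc].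
  exists (Seq c (Seq (clear k) (move (1 + k) k))). intros s Hs. eapply exec_seq; [apply Hc; auto|].
  eapply exec_seq; [apply exec_clear|].
  eapply exec_eq; [apply exec_move; lia|]. st_zero Hs.
Qed.

Lemma PR_iter f a b : PR f -> PR a -> PR b -> PR (fun x => Nat.iter (a x) f (b x)).
Proof.
  intros Hf Ha Hb.
  apply (PR_ext (fun x => (fun z => Nat.iter (nfst z) f (nsnd z)) (pair (a x) (b x)))).
  { intros x. now rewrite nfst_pair, nsnd_pair. }
  apply (PR_comp (fun z => Nat.iter (nfst z) f (nsnd z))); auto using PR_pair.
  intros k. destruct (exec_unpair k) as [c Hc], (Hf (1 + k)) as [d Hd].
  exists (Seq c (Seq (Loop k d) (move (1 + k) k))).
  intros s Hs. eapply exec_seq; [apply Hc; auto|].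
  set (n := nfst (s k)). set (y := nsnd (s k)).
  apply exec_seq with (s2 := upd (upd s (1 + k) (Nat.iter n f y)) k 0).
  - assert (H := exec_loop_family k d (fun v => upd (upd s (1 + k) (Nat.iter (n - v) f y)) k v) n).
    cbv beta in H. rewrite Nat.sub_diag, Nat.sub_0_r in H. simpl Nat.iter in H at 1.
    replace (upd (upd s k n) (1 + k) y) with (upd (upd s (1 + k) y) k n) by st_eq.
    apply H.
    + intros; apply upd_same.
    + intros v Hv. assert (E : n - v = S (n - S v)) by lia.
      eapply exec_eq; [apply Hd|].
      * intros j Hj. rewrite !upd_other by lia. apply Hs; lia.
      * rewrite E. simpl Nat.iter. rewrite !(upd_other _ k), upd_same by lia. st_eq.
  - eapply exec_eq; [apply exec_move; lia|]. st_zero Hs.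
Qed.

Create HintDb pr.
#[local] Hint Resolve PR_id PR_const PR_S PR_pair PR_nfst PR_nsnd : pr.
#[local] Hint Extern 3 (PR _) =>
  match goal with H : PR ?g |- PR (fun x => ?g (@?a x)) => apply (PR_comp g a H) end : pr.

Ltac pr := auto 200 with pr nocore.

(** Recursion with a parameter is plain iteration on triples of parameter, index and accumulator. *)
Lemma PR_rec (h : nat -> nat -> nat -> nat) a b : PR a -> PR b ->
  PR (fun z => h (nfst z) (nfst (nsnd z)) (nsnd (nsnd z))) ->
  PR (fun x => nat_rect (fun _ => nat) (b x) (fun i acc => h x i acc) (a x)).
Proof.
  intros Ha Hb Hh.
  apply (PR_ext (fun x => nsnd (nsnd (Nat.iter (a x)
    (fun z => pair (nfst z) (pair (S (nfst (nsnd z))) (h (nfst z) (nfst (nsnd z)) (nsnd (nsnd z)))))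
    (pair x (pair 0 (b x))))))).
  - intros x.
    match goal with |- nsnd (nsnd (Nat.iter _ ?g _)) = _ => set (G := g) end.
    assert (H : forall n, Nat.iter n G (pair x (pair 0 (b x))) =
      pair x (pair n (nat_rect (fun _ => nat) (b x) (fun i acc => h x i acc) n))).
    { induction n as [|n IH]; [reflexivity|]. cbn [Nat.iter nat_rect].
      change (G (Nat.iter n G (pair x (pair 0 (b x)))) =
        pair x (pair (S n) (h x n (nat_rect (fun _ => nat) (b x) (fun i acc => h x i acc) n)))).
      rewrite IH. unfold G. pair_simpl. reflexivity. }
    now rewrite H, !nsnd_pair.
  - apply PR_nsnd, PR_nsnd, PR_iter; pr.
Qed.

Lemma PR_iter_param (F : nat -> nat -> nat) a b : PR a -> PR b ->
  PR (fun z => F (nfst z) (nsnd z)) -> PR (fun x => Nat.iter (a x) (F x) (b x)).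
Proof.
  intros Ha Hb HF. apply (PR_rec (fun x _ acc => F x acc)); auto.
  apply (PR_ext (fun z => (fun w => F (nfst w) (nsnd w)) (pair (nfst z) (nsnd (nsnd z))))).
  - intros z. now pair_simpl.
  - apply (PR_comp (fun w => F (nfst w) (nsnd w))); pr.
Qed.

Lemma PR_case (h : nat -> nat -> nat) a b : PR a -> PR b ->
  PR (fun z => h (nfst z) (nsnd z)) ->
  PR (fun x => match a x with 0 => b x | S v => h x v end).
Proof.
  intros Ha Hb Hh.
  apply (PR_ext (fun x => nat_rect (fun _ => nat) (b x) (fun i acc => h x i) (a x))).
  { intros x. now destruct (a x). }
  apply (PR_rec (fun x i _ => h x i)); auto.
  apply (PR_ext (fun z => (fun w => h (nfst w) (nsnd w)) (pair (nfst z) (nfst (nsnd z))))).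
  - intros z. now pair_simpl.
  - apply (PR_comp (fun w => h (nfst w) (nsnd w))); pr.
Qed.

#[local] Hint Resolve PR_case PR_rec PR_iter_param : pr.

Lemma PR_pred f : PR f -> PR (fun x => pred (f x)).
Proof. unfold pred. pr. Qed.

Lemma PR_add f g : PR f -> PR g -> PR (fun x => f x + g x).
Proof.
  intros Hf Hg. apply (PR_ext (fun x => Nat.iter (f x) S (g x))); [|pr].
  intros x. induction (f x); simpl; auto.
Qed.
#[local] Hint Resolve PR_pred PR_add : pr.

Lemma PR_sub f g : PR f -> PR g -> PR (fun x => f x - g x).
Proof.
  intros Hf Hg. apply (PR_ext (fun x => Nat.iter (g x) pred (f x))); [|pr].
  intros x. induction (g x); simpl; lia.
Qed.

Lemma PR_mul f g : PR f -> PR g -> PR (fun x => f x * g x).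
Proof.
  intros Hf Hg. apply (PR_ext (fun x => Nat.iter (f x) (fun y => g x + y) 0)); [|pr].
  intros x. induction (f x); simpl; auto.
Qed.
#[local] Hint Resolve PR_sub PR_mul : pr.

Lemma PR_pow f g : PR f -> PR g -> PR (fun x => f x ^ g x).
Proof.
  intros Hf Hg. apply (PR_ext (fun x => Nat.iter (g x) (fun y => f x * y) 1)); [|pr].
  intros x. induction (g x); simpl; auto.
Qed.

Definition bsum (n : nat) (h : nat -> nat) : nat :=
  nat_rect (fun _ => nat) 0 (fun i acc => acc + h i) n.

Lemma PR_bsum (h : nat -> nat -> nat) a : PR a -> PR (fun z => h (nfst z) (nsnd z)) ->
  PR (fun x => bsum (a x) (fun i => h x i)).
Proof.
  intros Ha Hh. apply (PR_rec (fun x i acc => acc + h x i)); auto with pr.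
  apply PR_add; pr.
  apply (PR_ext (fun z => (fun w => h (nfst w) (nsnd w)) (pair (nfst z) (nfst (nsnd z))))).
  - intros z. now pair_simpl.
  - apply (PR_comp (fun w => h (nfst w) (nsnd w))); pr.
Qed.
#[local] Hint Resolve PR_pow PR_bsum : pr.

Lemma PR_div f g : PR f -> PR g -> PR (fun x => f x / g x).
Proof.
  intros Hf Hg.
  (* The quotient counts the [i < f x] with [S i * g x <= f x]; [1 - (u - v)] is the truth value of
     [u <= v]. Division by 0 yields 0. *)
  apply (PR_ext (fun x => match g x with 0 => 0 | S y =>
    bsum (f x) (fun i => 1 - (S i * g x - f x)) end)); [|pr].
  intros x. destruct (g x) as [|y]; [reflexivity|]. generalize (f x). clear. intros a.
  assert (H : forall n, bsum n (fun i => 1 - (S i * S y - a)) = min n (a / S y)).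
  { induction n as [|n IH]; [reflexivity|].
    change (bsum n (fun i => 1 - (S i * S y - a)) + (1 - (S n * S y - a)) = min (S n) (a / S y)).
    rewrite IH. destruct (le_lt_dec (S n * S y) a) as [L|L].
    - assert (S n <= a / S y) by (apply Nat.div_le_lower_bound; lia). lia.
    - assert (a / S y < S n) by (apply Nat.Div0.div_lt_upper_bound; lia). lia. }
  rewrite H. apply Nat.min_r. now apply Nat.Div0.div_le_upper_bound; nia.
Qed.
#[local] Hint Resolve PR_div : pr.

Lemma PR_mod f g : PR f -> PR g -> PR (fun x => f x mod g x).
Proof.
  intros Hf Hg. apply (PR_ext (fun x => f x - g x * (f x / g x))); [|pr].
  intros x. rewrite (Nat.Div0.div_mod (f x) (g x)) at 1. lia.
Qed.
#[local] Hint Resolve PR_mod : pr.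

(** * Decidable predicates and bounded quantifiers *)

(** Truth is the value 0, as in [recursive_pred]; a conjunction is then a sum, and a bounded
    universal quantifier a bounded sum. *)
Definition PRP (P : nat -> Prop) : Prop := exists g, PR g /\ forall x, P x <-> g x = 0.

Lemma PRP_and P Q : PRP P -> PRP Q -> PRP (fun x => P x /\ Q x).
Proof.
  intros (f & Hf & Ef) (g & Hg & Eg). exists (fun x => f x + g x). split; [pr|].
  intros x. rewrite Ef, Eg. lia.
Qed.

Lemma PRP_imp P Q : PRP P -> PRP Q -> PRP (fun x => P x -> Q x).
Proof.
  intros (f & Hf & Ef) (g & Hg & Eg). exists (fun x => g x * (1 - f x)). split; [pr|].
  intros x. rewrite Ef, Eg, Nat.mul_eq_0. lia.
Qed.

Lemma PRP_le f g : PR f -> PR g -> PRP (fun x => f x <= g x).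
Proof.
  intros Hf Hg. exists (fun x => f x - g x). split; [pr|]. intros x. lia.
Qed.

Lemma PRP_lt f g : PR f -> PR g -> PRP (fun x => f x < g x).
Proof. intros Hf Hg. apply (PRP_le (fun x => S (f x))); pr. Qed.

Lemma PRP_eq f g : PR f -> PR g -> PRP (fun x => f x = g x).
Proof.
  intros Hf Hg. exists (fun x => (f x - g x) + (g x - f x)). split; [pr|]. intros x. lia.
Qed.

Lemma bsum_0 n h : bsum n h = 0 <-> forall i, i < n -> h i = 0.
Proof.
  induction n as [|n IH]; [split; auto; lia|].
  change (bsum n h + h n = 0 <-> forall i, i < S n -> h i = 0). split.
  - intros H i Hi. destruct (Nat.eq_dec i n) as [->|]; [lia|]. apply IH; lia.
  - intros H. rewrite (proj2 IH), H; auto.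
Qed.

Lemma PRP_all (P : nat -> nat -> Prop) a : PR a -> PRP (fun z => P (nfst z) (nsnd z)) ->
  PRP (fun x => forall i, i < a x -> P x i).
Proof.
  intros Ha (g & Hg & Eg). exists (fun x => bsum (a x) (fun i => g (pair x i))). split.
  - apply PR_bsum; auto. apply (PR_comp g); pr.
  - intros x. rewrite bsum_0. split; intros H i Hi; specialize (H i Hi).
    + apply Eg. now pair_simpl.
    + apply Eg in H. now rewrite nfst_pair, nsnd_pair in H.
Qed.

Lemma PRP_ext P Q : (forall x, P x <-> Q x) -> PRP P -> PRP Q.
Proof. intros H (g & Hg & E). exists g. split; auto. intros x. now rewrite <- H. Qed.

Lemma PRP_False : PRP (fun _ => False).
Proof. exists (fun _ => 1). split; [pr|]. intros _. split; [easy|discriminate]. Qed.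

Lemma PRP_ex (P : nat -> nat -> Prop) a : PR a -> PRP (fun z => P (nfst z) (nsnd z)) ->
  PRP (fun x => exists i, i < a x /\ P x i).
Proof.
  intros Ha HP.
  apply (PRP_ext (fun x => (forall i, i < a x -> P x i -> False) -> False)).
  - intros x. split.
    + intros H. apply NNPP. intros H'. apply H. intros i Hi Hp. apply H'. eauto.
    + intros (i & Hi & Hp) H. eauto.
  - apply PRP_imp, PRP_False. apply (PRP_all (fun x i => P x i -> False)); auto.
    apply PRP_imp, PRP_False. exact HP.
Qed.

#[local] Hint Resolve PRP_and PRP_imp PRP_le PRP_lt PRP_eq PRP_all PRP_ex : pr.

Definition init (n r : nat) : nat := if Nat.eqb r 0 then n else 0.

Lemma compiled_run c n s' P : exec c (init n) s' -> P = compile 0 c ->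
  exists t, run P t (0, init n) = Some (s' 0).
Proof.
  intros H ->. destruct (compile_correct _ _ _ H (compile 0 c) 0) as [[t S] _].
  { intros i x; auto. }
  exists (t + 0). rewrite (run_steps _ _ _ _ _ S). simpl.
  rewrite (proj2 (nth_error_None _ _)); auto. now rewrite compile_length.
Qed.

Lemma PR_computable f : PR f -> computable f.
Proof.
  intros H. destruct (H 0) as [c Hc]. exists (prog_code (compile 0 c)). intros n.
  destruct (compiled_run c n (upd (init n) 0 (f n)) (compile 0 c)) as [t Ht]; auto.
  - apply (Hc (init n)). intros [|j] Hj; [lia|reflexivity].
  - exists t. unfold phi. rewrite prog_code_correct. exact Ht.
Qed.

Lemma PRP_recursive P : PRP P -> recursive_pred P.
Proof.
  intros (g & Hg & E). destruct (PR_computable g Hg) as [i Hi]. exists i. intros n.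
  destruct (Hi n) as [t Ht]. exists t, (g n). auto.
Qed.

(** * A simulator of the counter machine inside [PR] *)

(** Every number is an infinite stream: [pair a st] has head [a] and tail [st], and 0 is the zero
    stream because it codes (0, 0). No length has to be stored. The same coding later serves for
    lists of cylinders. *)
Definition lookup (r st : nat) : nat := nfst (Nat.iter r nsnd st).

(** The stream is rebuilt from the inside: the tail behind entry [r], then [v], then the old entries
    [r - 1], ..., 0 put in front one by one. *)
Definition update (r v st : nat) : nat :=
  nat_rect (fun _ => nat) (pair v (Nat.iter (S r) nsnd st))
    (fun i acc => pair (lookup (r - S i) st) acc) r.

Lemma iter_S_out A (f : A -> A) n x : Nat.iter (S n) f x = Nat.iter n f (f x).
Proof. induction n as [|n IH]; [reflexivity|]. simpl in *. now rewrite IH. Qed.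

Lemma lookup_0 a st : lookup 0 (pair a st) = a.
Proof. apply nfst_pair. Qed.

Lemma lookup_S j a st : lookup (S j) (pair a st) = lookup j st.
Proof. unfold lookup. now rewrite iter_S_out, nsnd_pair. Qed.

Lemma lookup_update r v st j : lookup j (update r v st) = if Nat.eqb j r then v else lookup j st.
Proof.
  unfold update.
  set (A := nat_rect (fun _ => nat) (pair v (Nat.iter (S r) nsnd st))
    (fun i acc => pair (lookup (r - S i) st) acc)).
  (* [A i] is the updated stream without its first [r - i] entries. *)
  assert (H : forall i j, i <= r ->
    lookup j (A i) = if Nat.eqb j i then v else lookup (r - i + j) st).
  { clear j. induction i as [|i IH]; intros [|j] Hi.
    - apply lookup_0.
    - change (A 0) with (pair v (Nat.iter (S r) nsnd st)). rewrite lookup_S.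
      unfold lookup. rewrite <- Nat.iter_add. simpl Nat.eqb. cbv iota.
      now replace (j + S r) with (r - 0 + S j) by lia.
    - change (A (S i)) with (pair (lookup (r - S i) st) (A i)).
      rewrite lookup_0. simpl Nat.eqb. cbv iota. f_equal. lia.
    - change (A (S i)) with (pair (lookup (r - S i) st) (A i)).
      rewrite lookup_S, IH by lia. simpl Nat.eqb. destruct (Nat.eqb_spec j i); auto.
      f_equal. lia. }
  rewrite H by lia. now rewrite Nat.sub_diag.
Qed.

(** The code of the program with [pc] instructions dropped. The value 0 means that none are left,
    and it is stable because [nsnd (pred 0) = 0]. *)
Definition fetch (pc e : nat) : nat := Nat.iter pc (fun m => nsnd (pred m)) e.

Lemma fetch_decode_fuel pc : forall f e, e <= f ->
  nth_error (decode_prog_fuel f e) pc =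
  match fetch pc e with 0 => None | S m => Some (instr_of_nat (nfst m)) end.
Proof.
  induction pc as [|pc IH]; intros f e H.
  - destruct f, e; simpl; auto; try lia.
    rewrite (surjective_pairing (of_nat e)). reflexivity.
  - unfold fetch. rewrite iter_S_out. fold (fetch pc (nsnd (pred e))).
    destruct e as [|e], f as [|f]; simpl pred; cbn [decode_prog_fuel nth_error]; try lia.
    + change (nsnd 0) with 0. rewrite <- (IH 0 0) by lia. now destruct pc.
    + change (nsnd 0) with 0. rewrite <- (IH 0 0) by lia. now destruct pc.
    + rewrite (surjective_pairing (of_nat e)). cbn [nth_error]. apply IH.
      assert (L := pair_snd_le (nfst e) (nsnd e)). rewrite pair_eta in L.
      change (nsnd e <= f). lia.
Qed.

Lemma fetch_decode pc e : nth_error (decode_prog e) pc =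
  match fetch pc e with 0 => None | S m => Some (instr_of_nat (nfst m)) end.
Proof. now apply fetch_decode_fuel. Qed.

(* A configuration is coded by [pair pc st], the register contents by the infinite stream of
   first components of [st]; a halted configuration is left unchanged. *)
Definition simstep (e z : nat) : nat :=
  match fetch (nfst z) e with
  | 0 => z
  | S m =>
      match nfst (nfst m) with
      | 0 => pair (nsnd (nsnd (nfst m)))
               (update (nfst (nsnd (nfst m))) (S (lookup (nfst (nsnd (nfst m))) (nsnd z))) (nsnd z))
      | S _ =>
          match lookup (nfst (nsnd (nfst m))) (nsnd z) with
          | 0 => pair (nsnd (nsnd (nsnd (nfst m)))) (nsnd z)
          | S v => pair (nfst (nsnd (nsnd (nfst m)))) (update (nfst (nsnd (nfst m))) v (nsnd z))
          end
      end
  end.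

Definition phic (e t n : nat) : nat :=
  let z := Nat.iter t (simstep e) (pair 0 (pair n 0)) in
  match fetch (nfst z) e with 0 => S (lookup 0 (nsnd z)) | S _ => 0 end.

Definition config_of (z : nat) : config := (nfst z, fun r => lookup r (nsnd z)).

Lemma config_ext (pc : nat) (s s' : nat -> nat) :
  (forall j, s j = s' j) -> Some (pc, s) = Some (pc, s').
Proof. intros H. now rewrite (functional_extensionality s s' H). Qed.

Lemma step_simstep e z : step (decode_prog e) (config_of z) =
  match fetch (nfst z) e with 0 => None | S _ => Some (config_of (simstep e z)) end.
Proof.
  unfold step, config_of, simstep. rewrite fetch_decode.
  destruct (fetch (nfst z) e) as [|m]; auto.
  unfold instr_of_nat. generalize (nfst m); clear m; intros I.
  rewrite (surjective_pairing (of_nat I)). fold (nfst I) (nsnd I).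
  generalize (nsnd I); intros J.
  rewrite (surjective_pairing (of_nat J)). fold (nfst J) (nsnd J).
  rewrite (surjective_pairing (of_nat (nsnd J))). fold (nfst (nsnd J)) (nsnd (nsnd J)).
  destruct (nfst I).
  - rewrite nfst_pair, nsnd_pair. apply config_ext. intros j.
    now rewrite lookup_update.
  - destruct (lookup (nfst J) (nsnd z)); rewrite nfst_pair, nsnd_pair; auto.
    apply config_ext. intros j. now rewrite lookup_update.
Qed.

(** [run] stops when the machine halts, whereas the iteration always takes [t] rounds; the two agree
    because halted configurations are fixed points of [simstep]. *)
Lemma run_sim e t : forall z, run (decode_prog e) t (config_of z) =
  (let z := Nat.iter t (simstep e) z in
   match fetch (nfst z) e with 0 => Some (lookup 0 (nsnd z)) | S _ => None end).
Proof.
  induction t as [|t IH]; intros z; cbn [run]; rewrite step_simstep; cbv zeta.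
  - simpl Nat.iter. now destruct (fetch (nfst z) e).
  - rewrite iter_S_out. destruct (fetch (nfst z) e) as [|m] eqn:E.
    + assert (F : simstep e z = z) by (unfold simstep; now rewrite E).
      rewrite F. assert (G : forall n, Nat.iter n (simstep e) z = z).
      { induction n as [|n IHn]; [reflexivity|]. now rewrite iter_S_out, F. }
      now rewrite G, E.
    + apply IH.
Qed.

Lemma phic_phi e t n : phic e t n = match phi e t n with None => 0 | Some m => S m end.
Proof.
  unfold phi, phic.
  replace (0, fun r => if Nat.eqb r 0 then n else 0) with (config_of (pair 0 (pair n 0))).
  - rewrite run_sim. cbv zeta. now destruct (fetch _ e).
  - unfold config_of. rewrite nfst_pair, nsnd_pair. f_equal.
    apply functional_extensionality. intros [|r]; unfold lookup.
    + apply nfst_pair.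
    + rewrite iter_S_out, nsnd_pair. simpl Nat.eqb. cbv iota.
      induction r as [|r IHr]; [reflexivity|]. now rewrite iter_S_out.
Qed.

Lemma PR_lookup f g : PR f -> PR g -> PR (fun x => lookup (f x) (g x)).
Proof. unfold lookup. pr. Qed.
#[local] Hint Resolve PR_lookup : pr.

Lemma PR_update f g h : PR f -> PR g -> PR h -> PR (fun x => update (f x) (g x) (h x)).
Proof.
  intros Hf Hg Hh.
  apply (PR_ext (fun x => (fun z => update (nfst z) (nfst (nsnd z)) (nsnd (nsnd z)))
    (pair (f x) (pair (g x) (h x))))).
  { intros x. now pair_simpl. }
  apply (PR_comp (fun z => update (nfst z) (nfst (nsnd z)) (nsnd (nsnd z)))); [|pr].
  unfold update. pr.
Qed.

Lemma PR_fetch f g : PR f -> PR g -> PR (fun x => fetch (f x) (g x)).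
Proof. unfold fetch. pr. Qed.
#[local] Hint Resolve PR_update PR_fetch : pr.

Lemma PR_simstep f g : PR f -> PR g -> PR (fun x => simstep (f x) (g x)).
Proof.
  intros Hf Hg.
  apply (PR_ext (fun x => (fun z => simstep (nfst z) (nsnd z)) (pair (f x) (g x)))).
  { intros x. now pair_simpl. }
  apply (PR_comp (fun z => simstep (nfst z) (nsnd z))); [|pr].
  unfold simstep. pr.
Qed.
#[local] Hint Resolve PR_simstep : pr.

Lemma PR_phic f g h : PR f -> PR g -> PR h -> PR (fun x => phic (f x) (g x) (h x)).
Proof.
  intros Hf Hg Hh.
  apply (PR_ext (fun x => (fun z => phic (nfst z) (nfst (nsnd z)) (nsnd (nsnd z)))
    (pair (f x) (pair (g x) (h x))))).
  { intros x. now pair_simpl. }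
  apply (PR_comp (fun z => phic (nfst z) (nfst (nsnd z)) (nsnd (nsnd z)))); [|pr].
  unfold phic. cbv zeta.
  pr.
Qed.
#[local] Hint Resolve PR_phic : pr.

(** * Finite strings as numbers, and membership in the trees *)

(** Bit [i] gets weight [2 ^ i], so that passing to a prefix of length [j] is reduction modulo
    [2 ^ j]. Conversely, [Nat.testbit] turns a number back into a sequence. *)
Fixpoint val (x : cantor) (n : nat) : nat :=
  match n with
  | 0 => 0
  | S n => val x n + (if x n then 2 ^ n else 0)
  end.

Lemma pow2_pos n : 0 < 2 ^ n.
Proof. induction n; simpl; lia. Qed.

Lemma val_lt x n : val x n < 2 ^ n.
Proof.
  induction n as [|n IH]; simpl; [lia|]. destruct (x n); lia.
Qed.

Lemma val_mod x n j : j <= n -> val x n mod 2 ^ j = val x j.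
Proof.
  induction 1 as [|n Hn IH].
  - apply Nat.mod_small, val_lt.
  - cbn [val]. replace (if x n then 2 ^ n else 0) with ((if x n then 2 ^ (n - j) else 0) * 2 ^ j).
    + rewrite Nat.Div0.mod_add. exact IH.
    + destruct (x n); [|reflexivity]. rewrite <- Nat.pow_add_r. f_equal. lia.
Qed.

Definition agree (n : nat) (x y : cantor) : Prop := forall m, m < n -> x m = y m.

Lemma agree_val n x y : agree n x y -> val x n = val y n.
Proof.
  induction n as [|n IH]; intros H; [reflexivity|]. cbn [val].
  rewrite IH, (H n); auto. intros m Hm. apply H. lia.
Qed.

Lemma val_agree n x y : val x n = val y n -> agree n x y.
Proof.
  induction n as [|n IH]; intros H m Hm; [lia|]. cbn [val] in H.
  assert (Hx := val_lt x n). assert (Hy := val_lt y n).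
  destruct (Nat.eq_dec m n) as [->|].
  - destruct (x n), (y n); auto; lia.
  - apply IH; [|lia]. destruct (x n), (y n); lia.
Qed.

Lemma val_testbit v m : val (Nat.testbit v) m = v mod 2 ^ m.
Proof.
  induction m as [|m IH]; [now rewrite Nat.mod_1_r|]. cbn [val]. rewrite IH.
  rewrite Nat.pow_succ_r', (Nat.mul_comm 2), Nat.Div0.mod_mul_r, <- Nat.testbit_spec'.
  destruct (Nat.testbit v m); cbn [Nat.b2n]; lia.
Qed.

Lemma restr_S x n : restr x (S n) = restr x n ++ [x n].
Proof. unfold restr. now rewrite seq_S, map_app. Qed.

Lemma restr_length x n : length (restr x n) = n.
Proof. unfold restr. now rewrite length_map, length_seq. Qed.

Lemma code_str_app s b : code_str (s ++ [b]) = code_str s + (1 + if b then 1 else 0) * 2 ^ length s.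
Proof.
  induction s as [|c s IH]; cbn [app code_str length].
  - destruct b; reflexivity.
  - rewrite IH, Nat.pow_succ_r'. destruct b, c; lia.
Qed.

(** The strings of length [n] have the codes from [2 ^ n - 1] to [2 ^ S n - 2]: the code plus 1 is
    the value with a leading binary digit 1 that marks the length. *)
Lemma code_str_restr x n : code_str (restr x n) = val x n + 2 ^ n - 1.
Proof.
  induction n as [|n IH]; [reflexivity|].
  rewrite restr_S, code_str_app, restr_length, IH. cbn [val]. rewrite Nat.pow_succ_r'.
  assert (H := pow2_pos n). destruct (x n); lia.
Qed.

Lemma restr_prefix x m n : m <= n -> is_prefix (restr x m) (restr x n).
Proof.
  intros H. exists (map x (seq m (n - m))). unfold restr.
  rewrite <- map_app, <- seq_app. repeat f_equal. lia.
Qed.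

Lemma prefix_restr tau x n : is_prefix tau (restr x n) ->
  length tau <= n /\ tau = restr x (length tau).
Proof.
  intros [rho E]. assert (L : length (restr x n) = length (tau ++ rho)) by now rewrite E.
  rewrite restr_length, length_app in L. split; [lia|].
  assert (H := restr_prefix x (length tau) n ltac:(lia)). destruct H as [rho' E'].
  rewrite E' in E. apply (f_equal (firstn (length tau))) in E.
  rewrite !firstn_app, firstn_all, restr_length, Nat.sub_diag in E.
  rewrite (firstn_all2 (n := length tau) (restr x (length tau))) in E by now rewrite restr_length.
  simpl in E. now rewrite !app_nil_r in E.
Qed.

(* The strings of length [m] in [T e], coded by their values [v < 2 ^ m]. *)
Definition inT (e m v : nat) : Prop :=
  forall j, j < S m -> phic e m (v mod 2 ^ j + 2 ^ j - 1) = 0.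

Lemma T_inT e x m : T e (restr x m) <-> inT e m (val x m).
Proof.
  unfold T, inT. rewrite restr_length. split.
  - intros H j Hj. rewrite val_mod, <- code_str_restr, phic_phi by lia.
    rewrite H; auto. apply restr_prefix. lia.
  - intros H tau Ht. destruct (prefix_restr _ _ _ Ht) as [L ->].
    specialize (H (length tau) ltac:(lia)).
    rewrite val_mod, <- code_str_restr, phic_phi in H by lia.
    now destruct (phi e m _).
Qed.

(** A shorter string tests fewer prefixes, each for fewer steps. *)
Lemma T_restr_le e x m n : m <= n -> T e (restr x n) -> T e (restr x m).
Proof.
  intros L H tau Ht. rewrite restr_length.
  destruct (prefix_restr _ _ _ Ht) as [L' ->].
  destruct (phi e m _) eqn:E; [exfalso|reflexivity].
  assert (F := H (restr x (length tau)) (restr_prefix x (length tau) n ltac:(lia))).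
  rewrite restr_length in F. rewrite (phi_mono _ _ _ _ _ L E) in F. discriminate.
Qed.

(** * The covering criterion and its complexity *)

Definition hits (m v z : nat) : Prop := nfst z <= m /\ v mod 2 ^ nfst z = nsnd z.

(* [F] codes a list of [k] cylinders, each given by its length and the value of its string. *)
Definition covers (e m k F : nat) : Prop :=
  forall v, v < 2 ^ m -> inT e m v -> exists i, i < k /\ hits m v (lookup i F).

(* [2 ^ m] times the sum of the weights [2 ^ - floor (l p / q)], where [l] is the length. *)
Definition weight (p q m k F : nat) : nat :=
  bsum k (fun i => 2 ^ (m - p * nfst (lookup i F) / q)).

(** After division by [2 ^ m]: a family covering level [m] has total weight at least 2^-a. The
    premise [a <= m] keeps the truncated subtraction [m - a] exact. *)
Definition heavy (p q e a m k F : nat) : Prop :=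
  a <= m -> covers e m k F -> 2 ^ (m - a) <= weight p q m k F.

Lemma PRP_inT f g h : PR f -> PR g -> PR h -> PRP (fun x => inT (f x) (g x) (h x)).
Proof. intros Hf Hg Hh. unfold inT. pr. Qed.
#[local] Hint Resolve PRP_inT : pr.

Lemma PRP_covers f g h k : PR f -> PR g -> PR h -> PR k ->
  PRP (fun x => covers (f x) (g x) (h x) (k x)).
Proof. intros Hf Hg Hh Hk. unfold covers, hits. pr. Qed.
#[local] Hint Resolve PRP_covers : pr.

(** [covers] quantifies only over [v < 2 ^ m], [i < k] and prefix lengths, so [heavy] is decidable;
    [m], [k] and [F] are packed into the single universal variable. *)
Lemma heavy_Sigma02 p q : Sigma02 (fun e => exists a, forall m k F, heavy p q e a m k F).
Proof.
  exists (fun z => heavy p q (nfst z) (nfst (nsnd z)) (nfst (nsnd (nsnd z)))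
    (nfst (nsnd (nsnd (nsnd z)))) (nsnd (nsnd (nsnd (nsnd z))))). split.
  - apply PRP_recursive. unfold heavy, weight. pr.
  - intros e. split; intros [a H]; exists a.
    + intros b. pair_simpl. apply H.
    + intros m k F. specialize (H (pair m (pair k F))). pair_simpl. revert H. now pair_simpl.
Qed.

(** * Compactness of Cantor space *)

(** A tree is presented as a decreasing sequence of conditions, the [m]-th depending on the first
    [m] bits only. [ext n y] says that the first [n] bits of [y] have extensions on every level;
    such a stem is prolonged bit by bit. *)
Lemma konig (P : nat -> cantor -> Prop) :
  (forall m, exists x, P m x) ->
  (forall m x y, agree m x y -> P m x -> P m y) ->
  (forall m n x, m <= n -> P n x -> P m x) ->
  exists x, forall m, P m x.
Proof.
  intros Hex Hag Hle.
  set (ext n y := forall m, exists x, agree n y x /\ P m x).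
  set (set_bit (y : cantor) n b := fun i => if Nat.eqb i n then b else y i : bool).
  assert (Hstep : forall n y, ext n y ->
    exists b, ext (S n) (set_bit y n b)).
  (* If the bit [true] fails at level [m0], extensions reaching level [max m m0] must have the bit
     [false], and they also reach level [m]. *)
  { intros n y Hy. destruct (classic (ext (S n) (set_bit y n true))) as [H|H]; eauto.
    exists false. apply not_all_ex_not in H as [m0 H0]. intros m.
    destruct (Hy (max m m0)) as (x & Ax & Px). exists x.
    split; [|apply (Hle _ (max m m0)); [lia|exact Px]].
    intros i Hi. unfold set_bit. destruct (Nat.eqb_spec i n) as [->|]; [|apply Ax; lia].
    destruct (x n) eqn:E; auto. exfalso. apply H0. exists x. split.
    - intros i' Hi'. unfold set_bit. destruct (Nat.eqb_spec i' n) as [->|]; [auto|apply Ax; lia].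
    - apply (Hle _ (max m m0)); auto. lia. }
  set (next n y := set_bit y n (epsilon (inhabits true) (fun b => ext (S n) (set_bit y n b)))).
  set (Y := nat_rect (fun _ => cantor) (fun _ => false) next).
  assert (HY : forall n, ext n (Y n)).
  { induction n as [|n IH].
    - intros m. destruct (Hex m) as [x Hx]. exists x. split; auto. intros i Hi. lia.
    - apply (epsilon_spec (inhabits true) (fun b => ext (S n) (set_bit (Y n) n b))).
      now apply Hstep. }
  assert (HS : forall n i, i <> n -> Y (S n) i = Y n i).
  { intros n i Hi. change (Y (S n)) with (next n (Y n)). unfold next, set_bit.
    destruct (Nat.eqb_spec i n); [contradiction|reflexivity]. }
  assert (HYle : forall n m i, i < m -> m <= n -> Y n i = Y m i).
  { intros n m i Hi. induction 1; auto. rewrite HS; auto. lia. }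
  (* Bit [i] is fixed at stage [S i] and never changes afterwards. *)
  exists (fun i => Y (S i) i). intros m. destruct (HY m m) as (x & Ax & Px).
  apply (Hag m x); auto. intros i Hi. rewrite <- (Ax i Hi). cbv beta.
  apply (HYle m (S i) i); lia.
Qed.

(** Otherwise the strings of [T e] that escape the first [m] cylinders of length at most [m] reach
    every level, and an infinite path through them lies in no cylinder. The bound is asserted for
    all [m >= N] because the level must later be raised beyond other constants. *)
Lemma compactness e (x : nat -> cantor) (l : nat -> nat) :
  (forall y, paths (T e) y -> exists i, agree (l i) (x i) y) ->
  exists N, forall m, N <= m -> forall y, T e (restr y m) ->
    exists i, i < N /\ l i <= m /\ agree (l i) (x i) y.
Proof.
  intros H. apply NNPP. intros Hn.
  destruct (konig (fun m y => T e (restr y m) /\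
      forall i, i < m -> l i <= m -> ~ agree (l i) (x i) y)) as [y Hy].
  - intros N. apply NNPP. intros HN. apply Hn. exists N. intros m Hm y Hy.
    apply NNPP. intros H'. apply HN. exists y. split; [now apply (T_restr_le _ _ N m)|].
    intros i Hi Hl A. apply H'. exists i. repeat split; auto. lia.
  - intros m y z A [Hy H']. split.
    + rewrite T_inT in *. now rewrite <- (agree_val m y z).
    + intros i Hi Hl A'. apply (H' i Hi Hl). intros j Hj. rewrite A by lia. auto.
  - intros m n y L [Hy H']. split; [now apply (T_restr_le _ _ m n)|].
    intros i Hi Hl. apply H'; lia.
  - destruct (H y) as [i A]; [intros n; apply Hy|].
    (* At this level cylinder [i] is both listed and short enough to count. *)
    destruct (Hy (max (S i) (l i))) as [_ H']. apply (H' i); auto; lia.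
Qed.

Open Scope R_scope.

(** * Distances, diameters and powers of two *)

Lemma inv_pow2_pos n : 0 < / 2 ^ n.
Proof. apply Rinv_0_lt_compat, pow_lt. lra. Qed.

Lemma inv_pow2_le m n : (m <= n)%nat -> / 2 ^ n <= / 2 ^ m.
Proof.
  intros H. apply Rinv_le_contravar; [apply pow_lt; lra|]. apply Rle_pow; [lra|auto].
Qed.

Lemma inv_pow2_S n : / 2 ^ S n = / 2 ^ n / 2.
Proof. simpl. rewrite Rinv_mult. lra. Qed.

Lemma inv_pow2_small eps : 0 < eps -> exists n, / 2 ^ n < eps.
Proof.
  intros H. destruct (pow_lt_1_zero (/ 2) ltac:(rewrite Rabs_pos_eq; lra) eps H) as [N HN].
  exists N. specialize (HN N (le_n N)). rewrite pow_inv in HN.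
  rewrite Rabs_pos_eq in HN; auto. apply Rlt_le, inv_pow2_pos.
Qed.

Lemma first_difference (x y : cantor) : x <> y -> exists n, x n <> y n /\ agree n x y.
Proof.
  intros H.
  assert (E : exists n, x n <> y n).
  { apply NNPP. intros H'. apply H. apply functional_extensionality. intros n.
    apply NNPP. intros Hn. apply H'. eauto. }
  destruct (dec_inh_nat_subset_has_unique_least_element _
    (fun n => classic (x n <> y n)) E) as [n [[Hn Hl] _]].
  exists n. split; auto. intros m Hm. apply NNPP. intros C. apply Hl in C. lia.
Qed.

Lemma dist_cases x y : (x = y /\ dist x y = 0) \/
  exists n, x n <> y n /\ agree n x y /\ dist x y = / 2 ^ n.
Proof.
  apply (epsilon_spec (inhabits 0) (fun r => (x = y /\ r = 0) \/
    exists n, x n <> y n /\ (forall m, (m < n)%nat -> x m = y m) /\ r = / 2 ^ n)).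
  destruct (classic (x = y)) as [E|E].
  - exists 0. auto.
  - destruct (first_difference x y E) as (n & Hn & A). exists (/ 2 ^ n). right. exists n. auto.
Qed.

Lemma dist_agree n x y : agree n x y -> dist x y <= / 2 ^ n.
Proof.
  intros A. destruct (dist_cases x y) as [[_ ->]|(k & Hk & _ & ->)].
  - apply Rlt_le, inv_pow2_pos.
  - apply inv_pow2_le. destruct (le_lt_dec n k) as [|L]; auto. destruct (Hk (A k L)).
Qed.

(** Distances are 0 or powers of 1/2, so nothing lies strictly between [/ 2 ^ n] and [2 * / 2 ^ n].
    The strict bound is what minimality of [n] supplies in [cylinder_around]. *)
Lemma agree_dist n x y : dist x y < 2 * / 2 ^ n -> agree n x y.
Proof.
  intros H. destruct (dist_cases x y) as [[-> _]|(k & _ & A & E)]; [intros m _; auto|].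
  rewrite E in H. intros m Hm. apply A.
  destruct (le_lt_dec n k) as [L|L]; [lia|].
  assert (F := inv_pow2_le (S k) n L). rewrite inv_pow2_S in F. lra.
Qed.

Lemma dist_le_1 x y : dist x y <= 1.
Proof. replace 1 with (/ 2 ^ 0) by (simpl; lra). apply dist_agree. intros m Hm. lia. Qed.

Lemma diam_cases (U : cantor -> Prop) :
  is_lub (fun v => exists x y, U x /\ U y /\ v = dist x y) (diam U)
  \/ ((~ exists x, U x) /\ diam U = 0).
Proof.
  apply (epsilon_spec (inhabits 0) (fun r =>
    is_lub (fun v => exists x y, U x /\ U y /\ v = dist x y) r \/ ((~ exists x, U x) /\ r = 0))).
  destruct (classic (exists x, U x)) as [[x Hx]|H].
  - destruct (completeness (fun v => exists x y, U x /\ U y /\ v = dist x y)) as [r Hr].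
    + exists 1. intros v (y & z & _ & _ & ->). apply dist_le_1.
    + exists (dist x x), x, x. auto.
    + exists r. auto.
  - exists 0. auto.
Qed.

Lemma dist_le_diam (U : cantor -> Prop) x y : U x -> U y -> dist x y <= diam U.
Proof.
  intros Hx Hy. destruct (diam_cases U) as [[H _]|[H _]].
  - apply H. eauto.
  - destruct H. eauto.
Qed.

Lemma diam_le (U : cantor -> Prop) r :
  0 <= r -> (forall x y, U x -> U y -> dist x y <= r) -> diam U <= r.
Proof.
  intros Hr H. destruct (diam_cases U) as [[_ L]|[_ ->]]; auto.
  apply L. intros v (x & y & Hx & Hy & ->). auto.
Qed.

Lemma rpow_nonneg r s : 0 <= rpow r s.
Proof. unfold rpow. destruct (Rlt_dec 0 r); [|lra]. apply Rlt_le, exp_pos. Qed.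

Lemma rpow_le r r' s : 0 < s -> r <= r' -> rpow r s <= rpow r' s.
Proof.
  intros Hs H. unfold rpow. destruct (Rlt_dec 0 r), (Rlt_dec 0 r'); try lra.
  - apply Rle_Rpower_l; lra.
  - apply Rlt_le, exp_pos.
Qed.

Lemma Rpower_inv_pow2 l s : Rpower (/ 2 ^ l) s = Rpower 2 (- (INR l * s)).
Proof.
  rewrite <- Rpower_pow, <- Rpower_Ropp, Rpower_mult by lra. f_equal. lra.
Qed.

Lemma inv_pow2_Rpower n : / 2 ^ n = Rpower 2 (- INR n).
Proof. now rewrite <- Rpower_pow, <- Rpower_Ropp by lra. Qed.

Lemma floor_le p q l : (p < q)%nat -> (p * l / q <= l)%nat.
Proof. intros H. apply Nat.Div0.div_le_upper_bound. nia. Qed.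

(** For [w > m] the truncated exponent gives 1, which only overestimates; so integer weights bound
    the real ones from above even for cylinders longer than the level. *)
Lemma pow_sub_ge m w : 2 ^ m * / 2 ^ w <= INR (2 ^ (m - w)).
Proof.
  rewrite pow_INR. replace (INR 2) with 2 by (simpl; lra).
  apply Rmult_le_reg_r with (2 ^ w); [apply pow_lt; lra|].
  rewrite Rmult_assoc, Rinv_l, Rmult_1_r, <- pow_add by (apply pow_nonzero; lra).
  apply Rle_pow; [lra|lia].
Qed.

Lemma pow_sub_eq m w : (w <= m)%nat -> INR (2 ^ (m - w)) = 2 ^ m * / 2 ^ w.
Proof.
  intros H. rewrite pow_INR. replace (INR 2) with 2 by (simpl; lra).
  replace m with (m - w + w)%nat at 2 by lia. rewrite pow_add. field. apply pow_nonzero. lra.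
Qed.

Lemma bsum_S n h : bsum (S n) h = (bsum n h + h n)%nat.
Proof. reflexivity. Qed.

Lemma bsum_ge_term n h i : (i < n)%nat -> (h i <= bsum n h)%nat.
Proof.
  induction n as [|n IH]; intros H; [lia|]. rewrite bsum_S.
  destruct (Nat.eq_dec i n) as [->|]; [lia|]. assert (h i <= bsum n h)%nat by (apply IH; lia). lia.
Qed.

(** * Finite sums and finite families *)

Definition Rsum (n : nat) (h : nat -> R) : R :=
  nat_rect (fun _ => R) 0 (fun i acc => acc + h i) n.

Lemma Rsum_S n h : Rsum (S n) h = Rsum n h + h n.
Proof. reflexivity. Qed.

Lemma sum_f_R0_Rsum n h : sum_f_R0 h n = Rsum (S n) h.
Proof. induction n as [|n IH]; [cbn; ring|]. now rewrite Rsum_S, <- IH. Qed.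

Lemma Rsum_le n h g : (forall i, (i < n)%nat -> h i <= g i) -> Rsum n h <= Rsum n g.
Proof.
  induction n as [|n IH]; intros H; [simpl; lra|]. rewrite !Rsum_S.
  apply Rplus_le_compat; auto.
Qed.

Lemma Rsum_scale c n h : Rsum n (fun i => c * h i) = c * Rsum n h.
Proof. induction n as [|n IH]; [simpl; lra|]. rewrite !Rsum_S, IH. lra. Qed.

Lemma Rsum_plus n h g : Rsum n (fun i => h i + g i) = Rsum n h + Rsum n g.
Proof. induction n as [|n IH]; [simpl; lra|]. rewrite !Rsum_S, IH. lra. Qed.

Lemma INR_bsum n h : INR (bsum n h) = Rsum n (fun i => INR (h i)).
Proof. induction n as [|n IH]; [reflexivity|]. now rewrite bsum_S, Rsum_S, plus_INR, IH. Qed.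

Lemma Rsum_support n k h : (forall i, 0 <= h i) -> (forall i, (k <= i)%nat -> h i = 0) ->
  Rsum n h <= Rsum k h.
Proof.
  intros H0 Hk.
  assert (Hm : forall a b, Rsum a h <= Rsum (a + b) h).
  { intros a b. induction b as [|b IH]; [rewrite Nat.add_0_r; lra|].
    rewrite Nat.add_succ_r, Rsum_S. specialize (H0 (a + b)%nat). lra. }
  assert (He : forall b, Rsum (k + b) h = Rsum k h).
  { intros b. induction b as [|b IH]; [now rewrite Nat.add_0_r|].
    rewrite Nat.add_succ_r, Rsum_S, IH, Hk by lia. lra. }
  rewrite <- (He n), Nat.add_comm. apply Hm.
Qed.

Lemma Rsum_geom n c : Rsum n (fun i => c * / 2 ^ S i) = c * (1 - / 2 ^ n).
Proof.
  rewrite Rsum_scale. f_equal. induction n as [|n IH]; [simpl; lra|].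
  rewrite Rsum_S, IH, inv_pow2_S. lra.
Qed.

Lemma stream_exists (h : nat -> nat) k : exists F, forall i, (i < k)%nat -> lookup i F = h i.
Proof.
  revert h; induction k as [|k IH]; intros h.
  - exists 0%nat. intros i Hi. lia.
  - destruct (IH (fun i => h (S i))) as [F HF]. exists (pair (h 0%nat) F).
    intros [|i] Hi; [apply lookup_0|]. rewrite lookup_S. apply HF. lia.
Qed.

(** * Positive measure is equivalent to the covering criterion *)

Section Exponent.

Variables p q : nat.
Hypothesis hp : (0 < p)%nat.
Hypothesis hpq : (p < q)%nat.

Let s := INR p / INR q.

Lemma INR_q_pos : 0 < INR q.
Proof. apply lt_0_INR. lia. Qed.

Lemma s_pos : 0 < s.
Proof. apply Rdiv_lt_0_compat; [apply lt_0_INR; lia|apply INR_q_pos]. Qed.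

Lemma floor_bounds l :
  INR (p * l / q) <= INR l * s < INR (p * l / q) + 1.
Proof.
  assert (Hq := INR_q_pos).
  assert (E : INR l * s = INR (p * l) / INR q) by (rewrite mult_INR; unfold s; field; lra).
  rewrite E. split.
  - apply Rmult_le_reg_r with (INR q); auto. unfold Rdiv.
    rewrite Rmult_assoc, Rinv_l, Rmult_1_r, <- mult_INR by lra. apply le_INR.
    rewrite (Nat.mul_comm _ q). apply Nat.Div0.mul_div_le.
  - apply Rmult_lt_reg_r with (INR q); auto. unfold Rdiv.
    rewrite Rmult_assoc, Rinv_l, Rmult_1_r, <- S_INR, <- mult_INR by lra. apply lt_INR.
    rewrite (Nat.mul_comm (S _)). apply Nat.mul_succ_div_gt. lia.
Qed.

Lemma rpow_le_weight l : rpow (/ 2 ^ l) s <= / 2 ^ (p * l / q).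
Proof.
  unfold rpow. destruct (Rlt_dec 0 (/ 2 ^ l)); [|apply Rlt_le, inv_pow2_pos].
  rewrite Rpower_inv_pow2, inv_pow2_Rpower. apply Rle_Rpower; [lra|].
  destruct (floor_bounds l). lra.
Qed.

Lemma weight_le_rpow l : / 2 ^ (p * l / q) <= 2 * rpow (/ 2 ^ l) s.
Proof.
  unfold rpow. destruct (Rlt_dec 0 (/ 2 ^ l)) as [|n]; [|destruct (n (inv_pow2_pos l))].
  rewrite Rpower_inv_pow2, inv_pow2_Rpower.
  rewrite <- (Rpower_1 2) at 2 by lra. rewrite <- Rpower_plus. apply Rle_Rpower; [lra|].
  destruct (floor_bounds l). lra.
Qed.

(** Take 2^-a below both [delta] and [c]. In a family of weight less than 2^-a each term is less
    than 2^-a, which forces lengths of at least [a], hence diameters below [delta]; the family would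
    be an admissible cover whose sum is below [c]. *)
Lemma Hausdorff_pos_heavy e : Hausdorff_pos s (paths (T e)) ->
  exists a, forall m k F, heavy p q e a m k F.
Proof.
  intros (delta & c & Hd & Hc & H).
  destruct (inv_pow2_small (Rmin delta c) (Rmin_pos _ _ Hd Hc)) as [a Ha].
  assert (Ha1 := Rmin_l delta c). assert (Ha2 := Rmin_r delta c).
  exists a. intros m k F Ham HF. apply Nat.nlt_ge. intros Hlt.
  set (l i := nfst (lookup i F)).
  (* Beyond [k] the sets are empty: they have diameter 0 and add nothing to the series. *)
  set (U i := fun x : cantor => (i < k)%nat /\ val x (l i) = nsnd (lookup i F)).
  assert (HU : forall i, diam (U i) <= / 2 ^ l i).
  { intros i. apply diam_le; [apply Rlt_le, inv_pow2_pos|].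
    intros x y [_ Hx] [_ Hy]. apply dist_agree, val_agree. congruence. }
  assert (H0 : forall i, (k <= i)%nat -> diam (U i) <= 0).
  { intros i Hi. apply diam_le; [lra|]. intros x y [Hx _]. lia. }
  assert (Hl : forall i, (i < k)%nat -> (a <= l i)%nat).
  { intros i Hi. assert (B := bsum_ge_term k (fun i => 2 ^ (m - p * nfst (lookup i F) / q))%nat i Hi).
    cbv beta in B. fold (l i) in B. unfold weight in Hlt.
    assert (C : (2 ^ (m - p * l i / q) < 2 ^ (m - a))%nat) by lia.
    apply Nat.pow_lt_mono_r_iff in C; [|lia]. assert (D := floor_le p q (l i) hpq). lia. }
  destruct (H U) with (c' := / 2 ^ a) as [N HN].
  - intros i. destruct (le_lt_dec k i) as [L|L]; [specialize (H0 i L); lra|].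
    specialize (HU i). assert (D := inv_pow2_le _ _ (Hl i L)). lra.
  - intros x Hx. destruct (HF (val x m)) as (i & Hi & Hm & Hv).
    + apply val_lt.
    + apply T_inT, Hx.
    + exists i. split; auto. now rewrite <- Hv, val_mod.
  - lra.
  - rewrite sum_f_R0_Rsum in HN.
    assert (S1 : Rsum (S N) (fun i => rpow (diam (U i)) s) <= Rsum k (fun i => rpow (diam (U i)) s)).
    { apply Rsum_support; [intros; apply rpow_nonneg|]. intros i Hi.
      unfold rpow. destruct (Rlt_dec 0 (diam (U i))); auto. specialize (H0 i Hi). lra. }
    assert (S2 : Rsum k (fun i => rpow (diam (U i)) s) <= Rsum k (fun i => / 2 ^ (p * l i / q))).
    { apply Rsum_le. intros i _. apply Rle_trans with (rpow (/ 2 ^ l i) s).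
      - apply rpow_le; [apply s_pos|apply HU].
      - apply rpow_le_weight. }
    assert (S3 : 2 ^ m * Rsum k (fun i => / 2 ^ (p * l i / q)) <= INR (weight p q m k F)).
    { unfold weight. rewrite INR_bsum, <- Rsum_scale. apply Rsum_le. intros i _. apply pow_sub_ge. }
    apply lt_INR in Hlt. rewrite pow_sub_eq in Hlt by auto.
    assert (P : 0 < 2 ^ m) by (apply pow_lt; lra).
    assert (2 ^ m * Rsum k (fun i => / 2 ^ (p * l i / q)) < 2 ^ m * / 2 ^ a) by lra.
    apply Rmult_lt_reg_l in H1; lra.
Qed.

(* A set of diameter 0 costs nothing, but the small cylinder covering it does: [eps] pays for it. *)
Lemma cylinder_around (U : cantor -> Prop) eps : 0 < eps ->
  exists (x : cantor) l, (forall y, U y -> agree l x y) /\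
    / 2 ^ (p * l / q) <= 2 * rpow (diam U) s + eps.
Proof.
  intros He. destruct (classic (exists x, U x)) as [[x Hx]|HU].
  - destruct (Rlt_dec 0 (diam U)) as [Hd|Hd].
    (* For the least [n] with [/ 2 ^ n <= diam U], the diameter is also below [2 * / 2 ^ n] (unless
       [n = 0]), so the cylinder of length [n] contains [U] and is no larger than [U] in
       diameter. *)
    + destruct (dec_inh_nat_subset_has_unique_least_element (fun n => / 2 ^ n <= diam U)
        (fun n => classic _)) as [n [[Hn Hl] _]].
      { destruct (inv_pow2_small _ Hd) as [n Hn]. exists n. lra. }
      exists x, n. split.
      * intros y Hy. destruct n as [|n]; [intros m Hm; lia|].
        apply agree_dist. assert (D := dist_le_diam U x y Hx Hy).
        assert (~ / 2 ^ n <= diam U) by (intros C; apply Hl in C; lia).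
        rewrite inv_pow2_S. lra.
      * assert (A := weight_le_rpow n). assert (B := rpow_le _ _ s s_pos Hn). lra.
    (* Length [n * q] makes the floor exact: the exponent is [p * n], which is at least [n]. *)
    + destruct (inv_pow2_small eps He) as [n Hn]. exists x, (n * q)%nat. split.
      * intros y Hy. apply agree_dist. assert (D := dist_le_diam U x y Hx Hy).
        assert (P := inv_pow2_pos (n * q)). lra.
      * assert (P := rpow_nonneg (diam U) s).
        assert (I := inv_pow2_le n (p * (n * q) / q)).
        rewrite Nat.mul_assoc, Nat.div_mul in * by lia.
        assert (n <= p * n)%nat by nia. specialize (I H). lra.
  - destruct (inv_pow2_small eps He) as [n Hn]. exists (fun _ => false), (n * q)%nat. split.
    * intros y Hy. destruct HU. eauto.
    * assert (P := rpow_nonneg (diam U) s).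
      assert (I := inv_pow2_le n (p * (n * q) / q)).
      rewrite Nat.mul_assoc, Nat.div_mul in * by lia.
      assert (n <= p * n)%nat by nia. specialize (I H). lra.
Qed.

Lemma heavy_Hausdorff_pos e a : (forall m k F, heavy p q e a m k F) ->
  Hausdorff_pos s (paths (T e)).
Proof.
  (* A cover of sum at most [c] becomes a family of cylinders of weight below [2 * c + c]: the
     factor 2 from [cylinder_around], plus tolerances [c * / 2 ^ S i] of total less than [c]. Any
     multiple of [c] from 3 on would contradict this; 4 is convenient. *)
  intros Crit. set (c := / 2 ^ a / 4).
  assert (Pa := inv_pow2_pos a). exists 1, c. repeat split; [lra|unfold c; lra|].
  intros U _ HU c' Hc'. apply NNPP. intros Hs.
  assert (Hsum : forall n, Rsum n (fun i => rpow (diam (U i)) s) <= c).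
  { intros [|n]; [simpl; unfold c; lra|]. apply Rnot_lt_le. intros L. apply Hs. exists n.
    rewrite sum_f_R0_Rsum. lra. }
  assert (Hcyl : forall i, exists xl : cantor * nat,
    (forall y, U i y -> agree (snd xl) (fst xl) y) /\
    / 2 ^ (p * snd xl / q) <= 2 * rpow (diam (U i)) s + c * / 2 ^ S i).
  { intros i. destruct (cylinder_around (U i) (c * / 2 ^ S i)) as (x & l & H).
    - apply Rmult_lt_0_compat; [unfold c; lra|apply inv_pow2_pos].
    - exists (x, l). exact H. }
  set (G i := proj1_sig (constructive_indefinite_description _ (Hcyl i))).
  assert (HG := fun i => proj2_sig (constructive_indefinite_description _ (Hcyl i))).
  fold G in HG. cbv beta in HG.
  set (x i := fst (G i)). set (l i := snd (G i)).
  destruct (compactness e x l) as [N HN].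
  { intros y Hy. destruct (HU y Hy) as [i Hi]. exists i. now apply HG. }
  (* The level must exceed [N] for compactness, [a] for the criterion, and every length [l i] with
     [i < N], so that no weight is truncated. *)
  set (m := (N + a + bsum N l)%nat).
  destruct (stream_exists (fun i => pair (l i) (val (x i) (l i))) N) as [F HF].
  assert (Lm : forall i, (i < N)%nat -> (l i <= m)%nat).
  { intros i Hi. assert (B := bsum_ge_term N l i Hi). unfold m. lia. }
  assert (C : (2 ^ (m - a) <= weight p q m N F)%nat).
  { apply Crit; [unfold m; lia|]. intros v Hv Hin.
    set (y := Nat.testbit v : cantor).
    assert (Ey : forall j, (j <= m)%nat -> val y j = (v mod 2 ^ j)%nat).
    { intros j _. apply val_testbit. }
    assert (Hy : T e (restr y m)).
    { apply T_inT. now rewrite Ey, Nat.mod_small by auto. }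
    destruct (HN m ltac:(unfold m; lia) y Hy) as (i & Hi & _ & A).
    exists i. split; auto. unfold hits. rewrite HF, nfst_pair, nsnd_pair by auto.
    split; auto. rewrite <- Ey by auto. symmetry. now apply agree_val. }
  apply le_INR in C. rewrite pow_sub_eq in C by (unfold m; lia).
  assert (W : INR (weight p q m N F) <= 2 ^ m * Rsum N (fun i => / 2 ^ (p * l i / q))).
  { unfold weight. rewrite INR_bsum, <- Rsum_scale. apply Rsum_le. intros i Hi.
    rewrite HF, nfst_pair by auto. rewrite pow_sub_eq; [lra|].
    assert (D := floor_le p q (l i) hpq). specialize (Lm i Hi). lia. }
  assert (P : 0 < 2 ^ m) by (apply pow_lt; lra).
  assert (C' : / 2 ^ a <= Rsum N (fun i => / 2 ^ (p * l i / q))).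
  { apply Rmult_le_reg_l with (2 ^ m); auto. lra. }
  assert (S1 : Rsum N (fun i => / 2 ^ (p * l i / q)) <=
    Rsum N (fun i => 2 * rpow (diam (U i)) s + c * / 2 ^ S i)).
  { apply Rsum_le. intros i _. apply HG. }
  rewrite Rsum_plus, Rsum_scale, Rsum_geom in S1.
  specialize (Hsum N). assert (PN := inv_pow2_pos N).
  assert (0 < c * / 2 ^ N) by (apply Rmult_lt_0_compat; [unfold c; lra|auto]).
  unfold c in *. lra.
Qed.

End Exponent.

Open Scope nat_scope.

(** * Programs with a built-in parameter *)

Fixpoint inc_chain (o n : nat) : list instr :=
  match n with
  | 0 => []
  | S n => INC 1 (S o) :: inc_chain (S o) n
  end.

Lemma inc_chain_length n : forall o, length (inc_chain o n) = n.
Proof. induction n; simpl; auto. Qed.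

Lemma inc_chain_steps P n : forall o s, code_at P o (inc_chain o n) ->
  steps P n (o, s) (o + n, upd s 1 (s 1 + n)).
Proof.
  induction n as [|n IH]; intros o s H.
  - rewrite !Nat.add_0_r. replace (upd s 1 (s 1)) with s by st_eq. constructor.
  - apply code_at_cons in H as [H0 H]. econstructor; [simpl; rewrite H0; reflexivity|].
    specialize (IH (S o) (upd s 1 (S (s 1))) H). rewrite upd_same in IH.
    replace (o + S n) with (S o + n) by lia.
    replace (upd s 1 (s 1 + S n)) with (upd (upd s 1 (S (s 1))) 1 (S (s 1) + n)) by st_eq.
    exact IH.
Qed.

(* The chain loading [n] into register 1 comes last, so that the addresses inside [Q] do not
   depend on [n]. *)
Definition loaded (Q : cmd) (n : nat) : list instr :=
  DEC 1 0 (csize Q + 3) :: compile 1 Q ++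
  DEC 0 (csize Q + 2) (csize Q + n + 4) :: INC 0 (csize Q + 2) ::
  inc_chain (csize Q + 3) n ++ [DEC 2 0 1].

Lemma PR_prog_code_app A X : PR (fun n => prog_code (X n)) ->
  PR (fun n => prog_code (A ++ X n)).
Proof. intros H. induction A as [|x A IH]; simpl; pr. Qed.

(** Only the exit address and the chain vary with [n]; the block [compile 1 Q] is a constant list in
    front of them. *)
Lemma PR_loaded Q : PR (fun n => prog_code (loaded Q n)).
Proof.
  unfold loaded. cbn [prog_code]. apply PR_S, PR_pair; [pr|].
  apply (PR_prog_code_app (compile 1 Q)). cbn [prog_code instr_code].
  set (o := csize Q + 3). set (tail := [DEC 2 0 1]).
  assert (H : PR (fun n => prog_code (inc_chain o n ++ tail))); [|pr; auto 20 with pr].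
  (* Lists are coded from the end: after [j] rounds the last [j] increments are present, and they
     start at address [o + n - j]. *)
  apply (PR_ext (fun n => nat_rect (fun _ => nat) (prog_code tail)
    (fun j acc => S (pair (pair 0 (pair 1 (o + n - j))) acc)) n)); [|pr].
  intros n.
  assert (H : forall j, j <= n -> nat_rect (fun _ => nat) (prog_code tail)
    (fun j acc => S (pair (pair 0 (pair 1 (o + n - j))) acc)) j =
    prog_code (inc_chain (o + n - j) j ++ tail)).
  { induction j as [|j IH]; intros Hj; [reflexivity|]. cbn [nat_rect]. rewrite IH by lia.
    cbn [inc_chain app prog_code instr_code].
    now replace (S (o + n - S j)) with (o + n - j) by lia. }
  rewrite H by auto. now replace (o + n - n) with o by lia.
Qed.

Lemma phi_None_loop e n pc s :
  (forall s, exists s', step (decode_prog e) (pc, s) = Some (pc, s')) ->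
  forall t, steps (decode_prog e) t (0, init n) (pc, s) -> forall t', phi e t' n = None.
Proof.
  intros H t St t'.
  assert (L : forall u s, run (decode_prog e) u (pc, s) = None).
  { induction u as [|u IH]; intros s0; destruct (H s0) as [s1 H1]; cbn [run]; now rewrite H1. }
  destruct (phi e t' n) eqn:E; auto.
  apply (phi_mono _ _ (t + t')) in E; [|lia].
  unfold phi in E. change (fun r => if Nat.eqb r 0 then n else 0) with (init n) in E.
  rewrite (run_steps _ _ _ _ _ St), L in E. discriminate.
Qed.

(** Registers 1 and 2 start at 0, so the outer [DEC] instructions act as jumps: to the chain, which
    puts [n] into register 1, and back to [Q]. The test of register 0 then either leaves the program
    or enters an instruction that jumps to itself. *)
Lemma loaded_halts Q n c s :
  exec Q (upd (init c) 1 n) s ->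
  (exists t, phi (prog_code (loaded Q n)) t c <> None) <-> s 0 = 0.
Proof.
  intros HQ. set (P := loaded Q n). set (M := S (csize Q)).
  assert (HP : code_at P 0 P) by (intros i x H; exact H).
  unfold P at 2, loaded in HP. apply code_at_cons in HP as [I0 HP].
  apply code_at_app in HP as [CQ HP]. rewrite compile_length in HP.
  change (1 + csize Q) with M in HP. apply code_at_cons in HP as [IM HP].
  apply code_at_cons in HP as [IM1 HP]. apply code_at_app in HP as [CI HP].
  rewrite inc_chain_length in HP. apply code_at_cons in HP as [IL _].
  assert (Len : length P = csize Q + n + 4).
  { unfold P, loaded. simpl length. rewrite length_app, compile_length. simpl length.
    rewrite length_app, inc_chain_length. simpl. lia. }
  replace (csize Q + 3) with (S (S M)) in * by lia.
  assert (Hrun : exists t, steps P t (0, init c) (M, s)).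
  { destruct (compile_correct _ _ _ HQ P 1 CQ) as [[t St] _].
    exists (S (n + S t)). econstructor; [cbn [step]; rewrite I0; reflexivity|].
    eapply steps_trans; [apply inc_chain_steps, CI|].
    econstructor; [|exact St]. cbn [step]. rewrite IL.
    rewrite (upd_other _ 1 _ 2) by lia. reflexivity. }
  destruct Hrun as [t St]. destruct (s 0) as [|v] eqn:E.
  - split; auto. intros _. exists (t + 1). unfold phi. rewrite prog_code_correct. fold P.
    change (fun r => if Nat.eqb r 0 then c else 0) with (init c).
    rewrite (run_steps _ _ _ _ _ St). cbn [run step]. rewrite IM, E. cbn [run step].
    rewrite (proj2 (nth_error_None _ _)) by lia. discriminate.
  - split; [|discriminate]. intros [u Hu]. destruct Hu.
    apply (phi_None_loop _ _ (S M) (upd s 0 v)) with (t := t + 1); rewrite prog_code_correct; fold P.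
    + intros s0. cbn [step]. rewrite IM1. replace (csize Q + 2) with (S M) by (unfold M; lia). eauto.
    + eapply steps_trans; [exact St|]. econstructor; [|constructor].
      cbn [step]. rewrite IM, E. now replace (csize Q + 2) with (S M) by (unfold M; lia).
Qed.

(** Reduces the construction of uniformly recursive trees to naming a decidable set of pairs: string
    code to be killed, parameter [n]. *)
Lemma PRP_semidecider K : PRP K -> exists f, computable f /\
  forall n c, (exists t, phi (f n) t c <> None) <-> K (pair c n).
Proof.
  intros (g & Hg & E). destruct (exec_pair 0) as [d Hd], (Hg 0) as [q Hq].
  exists (fun n => prog_code (loaded (Seq d q) n)). split.
  - apply PR_computable, PR_loaded.
  - intros n c. rewrite E.
    apply (loaded_halts (Seq d q) n c (upd (upd (upd (upd (init c) 1 n) 0 (pair c n)) 1 0) 0 (g (pair c n)))).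
    assert (Z : forall j, 1 < j -> upd (init c) 1 n j = 0).
    { intros [|[|j]] Hj; [lia|lia|reflexivity]. }
    eapply exec_seq; [apply Hd, Z|]. apply Hq.
    intros [|[|j]] Hj; [lia|reflexivity|reflexivity].
Qed.

(** * The trees of the reduction *)

(** With [z = pair c n], the number [S c] is the string with its leading digit 1. The congruence
    says that the string starts with 0^a 1, and the inequality [2 ^ S a <= S c] that this block fits
    into its length. The last clause says that program [i], the decider, has rejected (n, a, b) by
    time [t]. The search bounds for [b] and [t] grow with the string, so every refutation is
    eventually seen. *)
Definition killed (i z : nat) : Prop :=
  exists a, a < S (nfst z) /\ exists b, b < S (nfst z) /\ exists t, t < S (nfst z) /\
    (S (nfst z) mod 2 ^ S a = 2 ^ a /\ 2 ^ S a <= S (nfst z) /\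
     2 <= phic i t (pair (nsnd z) (pair a b))).

Lemma PRP_killed i : PRP (killed i).
Proof. unfold killed. pr. Qed.

Lemma killed_restr i n x j : killed i (pair (code_str (restr x j)) n) <->
  exists a b t m, a < j /\ b < val x j + 2 ^ j /\ t < val x j + 2 ^ j /\ val x (S a) = 2 ^ a /\
    phi i t (pair n (pair a b)) = Some (S m).
Proof.
  unfold killed. pair_simpl. rewrite code_str_restr.
  assert (P := pow2_pos j). assert (V := val_lt x j).
  replace (S (val x j + 2 ^ j - 1)) with (val x j + 2 ^ j) by lia.
  assert (Hmod : forall a, a < j -> (val x j + 2 ^ j) mod 2 ^ S a = val x (S a)).
  { intros a Ha. replace (2 ^ j) with (2 ^ (j - S a) * 2 ^ S a).
    - rewrite Nat.Div0.mod_add. now apply val_mod.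
    - rewrite <- Nat.pow_add_r. f_equal. lia. }
  split.
  - intros (a & Ha & b & Hb & t & Ht & Hm & Hle & Hp).
    assert (Haj : a < j).
    { assert (C : 2 ^ S a < 2 ^ S j) by (rewrite (Nat.pow_succ_r' 2 j); lia).
      apply Nat.pow_lt_mono_r_iff in C; lia. }
    rewrite phic_phi in Hp. destruct (phi i t _) as [[|m]|] eqn:E; try lia.
    exists a, b, t, m. rewrite <- Hmod by auto. auto.
  - intros (a & b & t & m & Ha & Hb & Ht & Hv & Hp).
    assert (Haj : a < 2 ^ j) by (apply Nat.lt_trans with j; auto; apply Nat.pow_gt_lin_r; lia).
    exists a. split; [lia|]. exists b. split; auto. exists t. split; auto.
    rewrite Hmod, phic_phi, Hp by auto. split; auto. split; [|lia].
    assert (2 ^ S a <= 2 ^ j) by (apply Nat.pow_le_mono_r; lia). lia.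
Qed.

Lemma T_no_kill e n i x m :
  (forall c, (exists t, phi e t c <> None) <-> killed i (pair c n)) ->
  (forall j, j <= m -> ~ killed i (pair (code_str (restr x j)) n)) -> T e (restr x m).
Proof.
  intros He H tau Ht. destruct (prefix_restr _ _ _ Ht) as [L ->].
  destruct (phi e _ _) eqn:E; auto. destruct (H (length tau) L).
  apply He. eexists. rewrite E. discriminate.
Qed.

(** If the program halts on the code of a prefix after [t] steps, the restriction to length
    [max j t] has already left the tree. *)
Lemma path_no_kill e n i x j :
  (forall c, (exists t, phi e t c <> None) <-> killed i (pair c n)) ->
  paths (T e) x -> ~ killed i (pair (code_str (restr x j)) n).
Proof.
  intros He Hx K. apply He in K as [t Ht]. apply Ht.
  assert (F := Hx (max j t) (restr x j) (restr_prefix x j (max j t) ltac:(lia))).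
  rewrite restr_length in F. destruct (phi e t _) eqn:E; auto.
  apply (phi_mono _ _ (max j t)) in E; [congruence|lia].
Qed.

Lemma val_pow2 x a : val x (S a) = 2 ^ a <-> x a = true /\ val x a = 0.
Proof.
  cbn [val]. assert (P := pow2_pos a). assert (V := val_lt x a).
  destruct (x a); (split; [intros H; split|intros [H H0]]); easy || lia.
Qed.

Lemma val_pow2_unique x a b : val x (S a) = 2 ^ a -> val x (S b) = 2 ^ b -> a = b.
Proof.
  assert (W : forall a b, a < b -> val x (S a) = 2 ^ a -> val x (S b) = 2 ^ b -> False).
  { clear a b. intros a b L Ha Hb. apply val_pow2 in Hb as [_ Hb].
    rewrite <- (val_mod x b), Hb, Nat.Div0.mod_0_l in Ha by lia. assert (P := pow2_pos a). lia. }
  intros Ha Hb. destruct (lt_eq_lt_dec a b) as [[L| ]|L]; auto; exfalso; eauto.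
Qed.

Lemma length_flat_map_bsum A (f : nat -> list A) k :
  length (flat_map f (seq 0 k)) = bsum k (fun i => length (f i)).
Proof.
  induction k as [|k IH]; [reflexivity|].
  rewrite seq_S, flat_map_app, length_app, IH, bsum_S. simpl. now rewrite app_nil_r.
Qed.

Lemma bsum_le k f g : (forall i, f i <= g i) -> bsum k f <= bsum k g.
Proof.
  intros H. induction k as [|k IH]; [auto|]. rewrite !bsum_S. specialize (H k). lia.
Qed.

(** By counting: the cylinder of length [a] has [2 ^ (m - a)] strings on level [m], and a cylinder
    of length [l] contains [2 ^ (m - l)] of them at most. Its weight is no smaller, since
    [p * l / q <= l]; this is where s < 1 enters. *)
Lemma cylinder_heavy p q e a u : p < q -> u < 2 ^ a ->
  (forall m v, a <= m -> v < 2 ^ m -> v mod 2 ^ a = u -> inT e m v) ->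
  forall m k F, heavy p q e a m k F.
Proof.
  intros Hpq Hu H m k F Ham HF.
  set (cyl l w := map (fun t => w + 2 ^ l * t) (seq 0 (2 ^ (m - l)))).
  assert (Hcyl : forall l w v, l <= m -> v < 2 ^ m -> v mod 2 ^ l = w -> In v (cyl l w)).
  { intros l w v Hl Hv Hw. apply in_map_iff. exists (v / 2 ^ l). split.
    - rewrite (Nat.div_mod_eq v (2 ^ l)) at 2. lia.
    - apply in_seq. split; [lia|]. rewrite Nat.add_0_l. apply Nat.Div0.div_lt_upper_bound.
      rewrite <- Nat.pow_add_r. now replace (l + (m - l)) with m by lia. }
  set (G i := let l := nfst (lookup i F) in if le_dec l m then cyl l (nsnd (lookup i F)) else []).
  assert (N : NoDup (cyl a u)).
  { apply NoDup_map_NoDup_ForallPairs; [|apply seq_NoDup].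
    intros t t' _ _ Ht. assert (P := pow2_pos a). nia. }
  assert (I : incl (cyl a u) (flat_map G (seq 0 k))).
  { intros v Hv. apply in_map_iff in Hv as (t & <- & Ht). apply in_seq in Ht.
    assert (Hlt : u + 2 ^ a * t < 2 ^ m).
    { replace (2 ^ m) with (2 ^ a * 2 ^ (m - a)).
      - assert (P := pow2_pos a). nia.
      - rewrite <- Nat.pow_add_r. f_equal. lia. }
    assert (Hmod : (u + 2 ^ a * t) mod 2 ^ a = u).
    { rewrite Nat.mul_comm, Nat.Div0.mod_add. now apply Nat.mod_small. }
    destruct (HF _ Hlt (H m _ Ham Hlt Hmod)) as (i & Hi & Hl & Hw).
    apply in_flat_map. exists i. split; [apply in_seq; lia|].
    unfold G. cbv zeta. destruct (le_dec _ m); [|contradiction]. now apply Hcyl. }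
  apply NoDup_incl_length in I; auto.
  unfold cyl at 1 in I. rewrite length_map, length_seq, length_flat_map_bsum in I.
  eapply Nat.le_trans; [exact I|]. apply bsum_le. intros i. unfold G. cbv zeta.
  destruct (le_dec _ m); simpl; [|lia].
  unfold cyl. rewrite length_map, length_seq. apply Nat.pow_le_mono_r; [lia|].
  assert (D := floor_le p q (nfst (lookup i F)) Hpq). lia.
Qed.

(** Cover by the same singleton over and over: its diameter is 0, and [rpow] gives it weight 0. *)
Lemma singleton_not_Hausdorff_pos s (X : cantor -> Prop) x0 :
  (forall x, X x -> x = x0) -> ~ Hausdorff_pos s X.
Proof.
  intros HX (delta & c & Hd & Hc & H).
  assert (D : (diam (fun x => x = x0) <= 0)%R).
  { apply diam_le; [lra|]. intros x y -> ->.
    destruct (dist_cases x0 x0) as [[_ ->]|(n & Hn & _)]; [lra|contradiction]. }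
  destruct (H (fun _ x => x = x0)) with (c' := 0%R) as [N HN]; auto.
  - intros _. lra.
  - intros x Hx. exists 0. auto.
  - rewrite sum_f_R0_Rsum in HN.
    assert (E : Rsum (S N) (fun _ => rpow (diam (fun x => x = x0)) s) = 0%R).
    { generalize (S N). induction n as [|n IH]; [reflexivity|]. rewrite Rsum_S, IH.
      unfold rpow. destruct (Rlt_dec 0 _); lra. }
    lra.
Qed.

Open Scope R_scope.

Theorem mainTheorem7 (p q : nat) (hp : (0 < p)%nat) (hpq : (p < q)%nat) :
  Sigma02_complete
    (fun e => Hausdorff_pos (INR p / INR q) (paths (T e))).
Proof.
  split.
  - destruct (heavy_Sigma02 p q) as (R & HR & E). exists R. split; auto.
    intros e. rewrite <- E. split.
    + now apply Hausdorff_pos_heavy.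
    + intros [a Ha]. now apply (heavy_Hausdorff_pos p q hp hpq e a).
  - intros B (R & [i HR] & E).
    destruct (PRP_semidecider (killed i) (PRP_killed i)) as (f & Hf & Hk).
    exists f. split; auto. intros n. specialize (Hk n). rewrite E. split.
    (* The string 0^a 1 has length [S a] and value [2 ^ a]. *)
    + intros [a Ha]. apply (heavy_Hausdorff_pos p q hp hpq (f n) (S a)).
      apply (cylinder_heavy _ _ _ _ (2 ^ a)); auto.
      { assert (P := pow2_pos a). simpl. lia. }
      intros m v Ham Hv Hmod.
      set (x := Nat.testbit v : cantor).
      assert (Vm : forall j, val x j = v mod 2 ^ j) by (intros; apply val_testbit).
      replace v with (val x m) by (rewrite Vm; now apply Nat.mod_small).
      apply T_inT. apply (T_no_kill _ n i); auto.
      intros j _ K. apply killed_restr in K as (a' & b & t & r & _ & _ & _ & Hva & Hp).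
      (* A sequence has only one first 1, so the kill concerns the witness [a] itself; the decider
         would reject a triple that satisfies [R]. *)
      rewrite <- Vm in Hmod. rewrite (val_pow2_unique x a' a Hva Hmod) in Hp.
      destruct (HR (pair n (pair a b))) as (t' & r' & Hp' & Er).
      rewrite (proj1 Er (Ha b)) in Hp'. assert (C := phi_det _ _ _ _ _ _ Hp Hp'). discriminate.
    + intros Hpos. apply NNPP. intros HB. revert Hpos.
      apply (singleton_not_Hausdorff_pos _ _ (fun _ => false)).
      intros x Hx. apply NNPP. intros Hne.
      destruct (first_difference x (fun _ => false) Hne) as (a & Hxa & Ag).
      apply HB. exists a. intros b. apply NNPP. intros Hnb.
      destruct (HR (pair n (pair a b))) as (t & r & Hp & Er).
      destruct r as [|r]; [now apply Hnb, Er|].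
      (* A prefix this long contains the whole block 0^a 1, and [b] and [t] are below [2 ^ j], hence
         within the search bounds. *)
      set (j := (S a + b + t)%nat).
      apply (path_no_kill (f n) n i x j Hk Hx). apply killed_restr.
      assert (G := Nat.pow_gt_lin_r 2 j ltac:(lia)).
      exists a, b, t, r. repeat split; auto; try (unfold j in *; lia).
      apply val_pow2. split; [now destruct (x a)|].
      rewrite (agree_val a x (fun _ => false) Ag). clear. induction a; simpl; auto. now rewrite IHa.
Qed.
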